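(* (i) For every $\phi\in \Sigma_3$ without free variables, Vertex-Removal to $\phi$ is {\sf FPT}. (ii) There is $\phi\in\Pi_3$ without free variables such that Vertex-Removal to $\phi$ is ${\sf W}[2]$-hard.
   Context: Formulas are first-order logic (FOL) formulas on undirected graphs in prenex normal form, using connectives, quantifiers over vertex variables, the adjacency predicate $u\sim v$ and equality. $\Sigma_0=\Pi_0$ are quantifier-free formulas; for $s\ge1$, $\Sigma_s$ consists of formulas $\exists x_1\cdots\exists x_t\,\psi$ with $\psi\in\Pi_{s-1}$, and $\Pi_s$ of formulas $\forall x_1\cdots\forall x_t\,\psi$ with $\psi\in\Sigma_{s-1}$ ($t=0$ allowed). Vertex-Removal to $\phi$: given a graph $G$ and integer $k$ (the parameter), decide whether there is $S\subseteq V(G)$ with $|S|\le k$ such that $G-S\models\phi$. The formula $\phi$ is fixed (constant size). *)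

(* Defs.v *)
From mathcomp Require Import all_boot.

Set Implicit Arguments.
Unset Strict Implicit.
Unset Printing Implicit Defensive.

(** * Model of computation

    The WHILE language of N. D. Jones (Computability and Complexity from a
    Programming Perspective): structured programs whose variables hold binary
    trees.  Evaluating an expression costs the total size of the values of all
    its subexpressions.  Every unit of cost is thus paid for by a tree node that
    is actually written down, so costs agree with Turing machine time up to a
    polynomial, and the size of an output never exceeds the cost of producing
    it by more than the size of the input. *)

Inductive tree := Leaf | Node of tree & tree.

Fixpoint tree_eqb (a b : tree) : bool :=
  match a, b with
  | Leaf, Leaf => true
  | Node a1 a2, Node b1 b2 => tree_eqb a1 b1 && tree_eqb a2 b2
  | _, _ => false
  end.

Fixpoint tsize (a : tree) : nat :=
  if a is Node a1 a2 then (tsize a1 + tsize a2).+1 else 1.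

Definition is_node (a : tree) : bool := if a is Node _ _ then true else false.

Definition tree_of_bool (b : bool) : tree := if b then Node Leaf Leaf else Leaf.
Definition tree_of_nat (n : nat) : tree := iter n (Node Leaf) Leaf.
Definition tree_of_seq (s : seq tree) : tree := foldr Node Leaf s.

Inductive expr :=
| EVar of nat
| ELeaf
| ENode of expr & expr
| EHd of expr
| ETl of expr
| EEq of expr & expr.

Definition store := nat -> tree.

Definition update (st : store) (x : nat) (a : tree) : store :=
  fun y => if y == x then a else st y.

Fixpoint eval (st : store) (e : expr) : tree :=
  match e with
  | EVar x => st x
  | ELeaf => Leaf
  | ENode e1 e2 => Node (eval st e1) (eval st e2)
  | EHd e1 => if eval st e1 is Node a _ then a else Leaf
  | ETl e1 => if eval st e1 is Node _ a then a else Leaf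
  | EEq e1 e2 => tree_of_bool (tree_eqb (eval st e1) (eval st e2))
  end.

Fixpoint ecost (st : store) (e : expr) : nat :=
  tsize (eval st e) +
  match e with
  | EVar _ | ELeaf => 0
  | EHd e1 | ETl e1 => ecost st e1
  | ENode e1 e2 | EEq e1 e2 => ecost st e1 + ecost st e2
  end.

Inductive cmd :=
| CAssign of nat & expr
| CSeq of cmd & cmd
| CIf of expr & cmd & cmd
| CWhile of expr & cmd.

(* [exec c st t st']: from the store [st], the command [c] terminates in the
   store [st'] at total cost [t]. *)
Inductive exec : cmd -> store -> nat -> store -> Prop :=
| exec_assign st x e :
    exec (CAssign x e) st (ecost st e) (update st x (eval st e))
| exec_seq st st1 st2 c1 c2 t1 t2 :
    exec c1 st t1 st1 -> exec c2 st1 t2 st2 ->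
    exec (CSeq c1 c2) st (t1 + t2) st2
| exec_if st st1 e c1 c2 t :
    exec (if is_node (eval st e) then c1 else c2) st t st1 ->
    exec (CIf e c1 c2) st (ecost st e + t) st1
| exec_while_stop st e c :
    ~~ is_node (eval st e) ->
    exec (CWhile e c) st (ecost st e) st
| exec_while_loop st st1 st2 e c t1 t2 :
    is_node (eval st e) ->
    exec c st t1 st1 -> exec (CWhile e c) st1 t2 st2 ->
    exec (CWhile e c) st (ecost st e + t1 + t2) st2.

(* Input and output are passed in variable 0; all other variables start as
   [Leaf]. *)
Definition runs (c : cmd) (a b : tree) (t : nat) : Prop :=
  exists2 st : store, exec c (update (fun=> Leaf) 0 a) t st & st 0 = b.

Definition computable (f : nat -> nat) : Prop :=
  exists c : cmd, forall n : nat,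
    exists t : nat, runs c (tree_of_nat n) (tree_of_nat (f n)) t.

(** * Parameterized problems *)

(* A language of pairs (x, k) is the special case where [inst] is the set of
   all such pairs.  Algorithms only need to treat the codes of instances. *)
Record pproblem := PProblem {
  inst : Type;
  code : inst -> tree;
  param : inst -> nat;
  yes : inst -> Prop }.

Definition FPT (P : pproblem) : Prop :=
  exists (c : cmd) (f : nat -> nat) (d : nat), computable f /\
    forall x : inst P, exists (r : tree) (t : nat),
      [/\ runs c (code x) r t,
          t <= f (param x) * tsize (code x) ^ d
        & is_node r <-> yes x].

Definition fpt_reduces (P Q : pproblem) : Prop :=
  exists (c : cmd) (f g : nat -> nat) (d : nat),
    [/\ computable f, computable g &
    forall x : inst P, exists (y : inst Q) (t : nat),
      [/\ runs c (code x) (code y) t,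
          t <= f (param x) * tsize (code x) ^ d,
          param y <= g (param x)
        & yes x <-> yes y]].

(** * Boolean circuits and the W-hierarchy

    A circuit is the sequence of its gates in a topological order whose last
    gate is the output; [GNot], [GAnd] and [GOr] refer to their in-neighbours
    by position.  Distinct occurrences of [GIn] are distinct variables. *)

Inductive gate := GIn | GNot of nat | GAnd of seq nat | GOr of seq nat.

Definition circuit := seq gate.

Definition inputs (g : gate) : seq nat :=
  match g with GIn => [::] | GNot i => [:: i] | GAnd s | GOr s => s end.

Definition is_input (g : gate) : bool := if g is GIn then true else false.

Definition gate_wf (i : nat) (g : gate) : bool :=
  [&& all (fun j => j < i) (inputs g), uniq (inputs g)
    & match g with GAnd s | GOr s => 2 <= size s | _ => true end].

Definition circuit_wf (c : circuit) : bool :=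
  (0 < size c) && all (fun i => gate_wf i (nth GIn c i)) (iota 0 (size c)).

(* Assigns to each gate a value computed from those of the earlier gates. *)
Definition annotate (T : Type) (step : seq T -> gate -> T) (c : circuit) :
    seq T :=
  foldl (fun vs g => rcons vs (step vs g)) [::] c.

Definition gate_value (a : pred nat) (vs : seq bool) (g : gate) : bool :=
  match g with
  | GIn => a (size vs)
  | GNot i => ~~ nth false vs i
  | GAnd s => all (nth false vs) s
  | GOr s => has (nth false vs) s
  end.

Definition circuit_value (a : pred nat) (c : circuit) : bool :=
  last false (annotate (gate_value a) c).

(* Maximal number of edges on a path from an input to the output. *)
Definition depth (c : circuit) : nat :=
  last 0 (annotate (fun vs g =>
    if is_input g then 0 else (\max_(i <- inputs g) nth 0 vs i).+1) c).

(* Maximal number of large gates (in-degree greater than 2) on such a path. *)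
Definition weft (c : circuit) : nat :=
  last 0 (annotate (fun vs g =>
    (2 < size (inputs g)) + \max_(i <- inputs g) nth 0 vs i) c).

(* Number of input gates that are set to true. *)
Definition weight (a : pred nat) (c : circuit) : nat :=
  count (fun i => is_input (nth GIn c i) && a i) (iota 0 (size c)).

Definition tree_of_gate (g : gate) : tree :=
  let tag := match g with GIn => 0 | GNot _ => 1 | GAnd _ => 2 | GOr _ => 3 end in
  Node (tree_of_nat tag) (tree_of_seq (map tree_of_nat (inputs g))).

Definition tree_of_circuit (c : circuit) : tree :=
  tree_of_seq (map tree_of_gate c).

Definition weighted_circuit_sat (t d : nat) : pproblem :=
  @PProblem
    ({c : circuit | [&& circuit_wf c, weft c <= t & depth c <= d]} * nat)
    (fun x => Node (tree_of_circuit (val x.1)) (tree_of_nat x.2))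
    (fun x => x.2)
    (fun x => exists2 a : pred nat,
       weight a (val x.1) = x.2 & circuit_value a (val x.1)).

Definition in_W (t : nat) (P : pproblem) : Prop :=
  exists2 d : nat, 0 < d & fpt_reduces P (weighted_circuit_sat t d).

Definition W_hard (t : nat) (P : pproblem) : Prop :=
  forall Q : pproblem, in_W t Q -> fpt_reduces Q P.

(** * Graphs and first-order formulas *)

Record sgraph := SGraph {
  vertex : finType;
  adj : rel vertex;
  adj_sym : symmetric adj;
  adj_irr : irreflexive adj }.

Section Delete.
Variables (G : sgraph) (S : {set vertex G}).

Definition del_adj : rel {v : vertex G | v \notin S} :=
  fun u v => adj (val u) (val v).

Lemma del_adj_sym : symmetric del_adj.
Proof. by move=> u v; rewrite /del_adj adj_sym. Qed.

Lemma del_adj_irr : irreflexive del_adj.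
Proof. by move=> u; rewrite /del_adj adj_irr. Qed.

Definition delete : sgraph := SGraph del_adj_sym del_adj_irr.
End Delete.

(* Variables are well-scoped de Bruijn indices: those of a formula in
   [fo m] range over ['I_m], and a quantifier binds index 0. *)
Inductive qf (m : nat) : Type :=
| Adj of 'I_m & 'I_m
| Equal of 'I_m & 'I_m
| Not of qf m
| And of qf m & qf m
| Or of qf m & qf m
| Imp of qf m & qf m
| Iff of qf m & qf m.

Inductive fo (m : nat) : Type :=
| Matrix of qf m
| Ex of fo m.+1
| All of fo m.+1.

Definition sentence := fo 0.

Inductive Sigma : nat -> forall m : nat, fo m -> Prop :=
| Sigma_qf m (q : qf m) : Sigma 0 (Matrix q)
| Sigma_Pi s m (phi : fo m) : Pi s phi -> Sigma s.+1 phi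
| Sigma_Ex s m (phi : fo m.+1) : Sigma s.+1 phi -> Sigma s.+1 (Ex phi)
with Pi : nat -> forall m : nat, fo m -> Prop :=
| Pi_qf m (q : qf m) : Pi 0 (Matrix q)
| Pi_Sigma s m (phi : fo m) : Sigma s phi -> Pi s.+1 phi
| Pi_All s m (phi : fo m.+1) : Pi s.+1 phi -> Pi s.+1 (All phi).

Fixpoint qf_sat (G : sgraph) (m : nat) (q : qf m) (e : m.-tuple (vertex G)) :
    bool :=
  match q with
  | Adj i j => adj (tnth e i) (tnth e j)
  | Equal i j => tnth e i == tnth e j
  | Not q1 => ~~ qf_sat q1 e
  | And q1 q2 => qf_sat q1 e && qf_sat q2 e
  | Or q1 q2 => qf_sat q1 e || qf_sat q2 e
  | Imp q1 q2 => qf_sat q1 e ==> qf_sat q2 e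
  | Iff q1 q2 => qf_sat q1 e == qf_sat q2 e
  end.

Fixpoint sat (G : sgraph) (m : nat) (phi : fo m) :
    m.-tuple (vertex G) -> Prop :=
  match phi with
  | Matrix q => fun e => qf_sat q e
  | Ex psi => fun e => exists v : vertex G, sat psi [tuple of v :: e]
  | All psi => fun e => forall v : vertex G, sat psi [tuple of v :: e]
  end.

Definition models (G : sgraph) (phi : sentence) : Prop :=
  sat phi ([tuple] : 0.-tuple (vertex G)).

(* Adjacency matrix, row by row. *)
Definition tree_of_graph (G : sgraph) : tree :=
  tree_of_seq [seq tree_of_seq [seq tree_of_bool (adj u v) | v <- enum (vertex G)]
              | u <- enum (vertex G)].

Definition vertex_removal (phi : sentence) : pproblem :=
  @PProblem (sgraph * nat)
    (fun x => Node (tree_of_graph x.1) (tree_of_nat x.2))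
    (fun x => x.2)
    (fun x => exists S : {set vertex x.1},
       #|S| <= x.2 /\ models (delete S) phi).

(* Main.v *)
Require Import Defs.
From mathcomp Require Import all_boot zify.
Import Defs.

Set Implicit Arguments.
Unset Strict Implicit.
Unset Printing Implicit Defensive.

(* (i) Deleting vertices only removes witnesses for the innermost existential block.  So if, for fixed
   values of the outermost block, a tuple [y] of undeleted vertices has no witness, then one of the
   vertices of [y] must be deleted as well.  Branching over them gives a search tree of constant
   degree and depth [k] below each choice of the outermost block.

   (ii) Let a circuit of weft 2 and depth [d] be given.  A gate with at most two inputs inherits a
   certificate for its value from its inputs, and so does a large disjunction that is true or a large
   conjunction that is false; in the remaining cases the value of a large gate serves as its own
   certificate.  So the output is true iff there is a set of at most [2 ^ d] claims which force it,
   and each set of at most [2 ^ d] claims about gates of weft at most 1 that would refute one of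
   them contains a claim that is itself refuted by [2 ^ d] literals.  If a set of [k] inputs is
   given by the gaps between consecutive members, negative literals become positive as well, and we
   arrive at a covering problem: select at most [k + 2] items such that for each clause one of
   its terms, a set of boundedly many items, is selected.  In the graph, selecting an item means
   deleting it; everything else comes in more copies than can be destroyed. *)

(** * Polynomial-time programs *)

(** The obstacle in (ii) is that deletion is monotone: a deleted vertex can show that an item is
    selected, but nothing in the graph can show that an item is not selected. So all evidence has to
    be positive. Uniqueness of a selection is forced by counting: there are [k + 1] steps from 0
    over the [k] chosen inputs to the end, and one certificate; each of these [k + 2] groups must be
    hit, and the budget is [k + 2]. The bound [2 ^ d] arises because certificates are joined only at
    gates with at most two inputs, so they at most double with each unit of depth. As [d] is a
    constant, there are polynomially many certificates, objections and terms, and each term can have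
    a vertex of its own. Weft 2 yields exactly two rounds, objection and reply, since passing a
    large gate lowers the weft. Algorithms and reductions have to be actual WHILE programs with cost
    bounds. They are obtained from a calculus of polynomial-time functions whose only source of
    loops is the left fold. *)

Lemma tree_eqbP a b : reflect (a = b) (tree_eqb a b).
Proof.
elim: a b => [|a1 IH1 a2 IH2] [|b1 b2] /=; try by constructor.
by apply: (iffP andP) => [[/IH1-> /IH2->]|[<- <-]] //; split; [apply/IH1|apply/IH2].
Qed.

Lemma tsize_gt0 a : 0 < tsize a.
Proof. by case: a. Qed.

Lemma tsize_eval st e : tsize (eval st e) <= ecost st e.
Proof. by case: e => * /=; lia. Qed.

(** Each assignment pays for the size of the value that it stores, so time bounds space; output
    sizes are bounded by running times in this way. *)
Lemma exec_tsize c st t st' y : exec c st t st' -> tsize (st' y) <= tsize (st y) + t.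
Proof.
elim=> {c st t st'} //=.
- by move=> st x e; rewrite /update; case: eqP => _; have := tsize_eval st e; lia.
- by move=> *; lia.
- by move=> *; lia.
- by move=> *; lia.
- by move=> *; lia.
Qed.

(** A weakest precondition that tracks cost: in the rules below, the rest of a program becomes the
    postcondition of its first command, so that a program is executed symbolically. *)
Definition reaches (c : cmd) (st : store) (Q : nat -> store -> Prop) : Prop :=
  exists t st', exec c st t st' /\ Q t st'.

Lemma reaches_mono c st (Q Q' : nat -> store -> Prop) :
  reaches c st Q -> (forall t st', Q t st' -> Q' t st') -> reaches c st Q'.
Proof. by case=> t [st' [H HQ]] imp; exists t, st'; split=> //; apply: imp. Qed.

Lemma reaches_assign st x e (Q : nat -> store -> Prop) :
  Q (ecost st e) (update st x (eval st e)) -> reaches (CAssign x e) st Q.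
Proof. by exists (ecost st e), (update st x (eval st e)); split=> //; constructor. Qed.

Lemma reaches_seq c1 c2 st (Q : nat -> store -> Prop) :
  reaches c1 st (fun t1 st1 => reaches c2 st1 (fun t2 => Q (t1 + t2))) ->
  reaches (CSeq c1 c2) st Q.
Proof.
case=> t1 [st1 [H1 [t2 [st2 [H2 HQ]]]]]; exists (t1 + t2), st2; split=> //.
exact: exec_seq H1 H2.
Qed.

Lemma reaches_if e c1 c2 st (Q : nat -> store -> Prop) :
  reaches (if is_node (eval st e) then c1 else c2) st (fun t => Q (ecost st e + t)) ->
  reaches (CIf e c1 c2) st Q.
Proof. by case=> t [st1 [H HQ]]; exists (ecost st e + t), st1; split=> //; constructor. Qed.

Lemma reaches_stop e c st (Q : nat -> store -> Prop) :
  ~~ is_node (eval st e) -> Q (ecost st e) st -> reaches (CWhile e c) st Q.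
Proof. by move=> *; exists (ecost st e), st; split=> //; constructor. Qed.

Lemma reaches_loop e c st (Q : nat -> store -> Prop) :
  is_node (eval st e) ->
  reaches c st (fun t1 st1 => reaches (CWhile e c) st1 (fun t2 => Q (ecost st e + t1 + t2))) ->
  reaches (CWhile e c) st Q.
Proof.
move=> He [t1 [st1 [H1 [t2 [st2 [H2 HQ]]]]]]; exists (ecost st e + t1 + t2), st2.
by split=> //; apply: exec_while_loop H1 H2.
Qed.

(** * Encodings of data as trees *)

Class encodable (T : Type) := Encodable { enc : T -> tree; enc_inj : injective enc }.

Lemma tree_of_nat_inj : injective tree_of_nat.
Proof. by elim=> [|m IH] [|n] //= [/IH->]. Qed.
#[export] Instance enc_nat : encodable nat := Encodable tree_of_nat_inj.

Lemma tree_of_bool_inj : injective tree_of_bool.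
Proof. by case; case. Qed.
#[export] Instance enc_bool : encodable bool := Encodable tree_of_bool_inj.

Lemma tree_of_unit_inj : injective (fun _ : unit => Leaf).
Proof. by case; case. Qed.
#[export] Instance enc_unit : encodable unit := Encodable tree_of_unit_inj.

Lemma tree_of_pair_inj A B (EA : encodable A) (EB : encodable B) :
  injective (fun p : A * B => Node (enc p.1) (enc p.2)).
Proof. by move=> [a b] [c d] /= [/(@enc_inj _ EA)-> /(@enc_inj _ EB)->]. Qed.
#[export] Instance enc_pair A B (EA : encodable A) (EB : encodable B) : encodable (A * B) :=
  Encodable (@tree_of_pair_inj A B EA EB).

Lemma tree_of_seq_inj A (EA : encodable A) :
  injective (fun s : seq A => tree_of_seq (map enc s)).
Proof. by elim=> [|a s IH] [|b t] //= [/(@enc_inj _ EA)-> /IH->]. Qed.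
#[export] Instance enc_seq A (EA : encodable A) : encodable (seq A) :=
  Encodable (@tree_of_seq_inj A EA).

Lemma tree_of_gate_inj : injective tree_of_gate.
Proof.
have inputs_inj s t : tree_of_seq (map tree_of_nat s) = tree_of_seq (map tree_of_nat t) -> s = t.
  by move/(@tree_of_seq_inj _ enc_nat).
case=> [|i|s|s] [|j|t|t] //= H; first by case: H => /tree_of_nat_inj->.
- by case: H => /inputs_inj->.
- by case: H => /inputs_inj->.
Qed.
#[export] Instance enc_gate : encodable gate := Encodable tree_of_gate_inj.

Definition esize (T : Type) (E : encodable T) (x : T) : nat := tsize (enc x).
Arguments esize {T E} x.

Lemma esize_gt0 T {E : encodable T} (x : T) : 0 < esize x.
Proof. exact: tsize_gt0. Qed.

Lemma esize_pair A B (EA : encodable A) (EB : encodable B) (p : A * B) :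
  esize p = (esize p.1 + esize p.2).+1.
Proof. by []. Qed.

Lemma esize_cons A (EA : encodable A) (a : A) s : esize (a :: s) = (esize a + esize s).+1.
Proof. by []. Qed.

Lemma esize_bool (b : bool) : esize b <= 3.
Proof. by case: b. Qed.

Lemma esize_nat (n : nat) : esize n = n.*2.+1.
Proof. by elim: n => //= n; rewrite /esize /= => ->. Qed.

Section PolynomialBounds.
Variable T : Type.
Implicit Types N F G : T -> nat.

(** The base is at least 2, so that a single exponent absorbs constants, factors and sums. *)
Definition pbound N F := exists d, forall x, F x <= (N x).+2 ^ d.

Lemma pbound_le N F G : (forall x, F x <= G x) -> pbound N G -> pbound N F.
Proof. by move=> le [d H]; exists d => x; apply: leq_trans (H x). Qed.

Lemma pbound_const N k : pbound N (fun=> k).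
Proof.
exists k => x; apply: leq_trans (ltnW (ltn_expl k (ltnSn 1))) _.
by case: k => // k; rewrite leq_exp2r.
Qed.

Lemma pbound_self N : pbound N N.
Proof. by exists 1 => x; rewrite expn1; lia. Qed.

Lemma pbound_mul N F G : pbound N F -> pbound N G -> pbound N (fun x => F x * G x).
Proof. by case=> d H [e K]; exists (d + e) => x; rewrite expnD leq_mul. Qed.

Lemma pbound_add N F G : pbound N F -> pbound N G -> pbound N (fun x => F x + G x).
Proof.
case=> d H [e K]; exists (d + e).+1 => x.
have h1 : (N x).+2 ^ d <= (N x).+2 ^ (d + e) by rewrite leq_exp2l // leq_addr.
have h2 : (N x).+2 ^ e <= (N x).+2 ^ (d + e) by rewrite leq_exp2l // leq_addl.
have := H x; have := K x; rewrite expnS; set X := _ ^ (d + e) in h1 h2 *; nia.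
Qed.

Lemma pbound_exp N F e : pbound N F -> pbound N (fun x => F x ^ e).
Proof.
move=> H; elim: e => [|e IH].
  by apply: pbound_le (pbound_const N 1) => x; rewrite expn0.
by apply: pbound_le (pbound_mul H IH) => x; rewrite expnS.
Qed.

End PolynomialBounds.

Lemma pbound_comp S T (h : S -> T) (N : S -> nat) (M F : T -> nat) :
  pbound M F -> pbound N (M \o h) -> pbound N (F \o h).
Proof.
case=> d H HM; apply: (@pbound_le _ _ _ (fun x => (M (h x) + 2) ^ d)).
  by move=> x /=; rewrite addn2.
by apply/pbound_exp/pbound_add => //; apply: pbound_const.
Qed.

Ltac pbound_tac := repeat first
  [ assumption | apply: pbound_self | apply: pbound_const | apply: pbound_add
  | apply: pbound_mul | apply: pbound_exp ].

(** The number [m] is a frame: variables from [m] on are left unchanged and serve as scratch space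
    for the programs that contain this one. *)
Definition computes A B (EA : encodable A) (EB : encodable B) (f : A -> B) (T : A -> nat) :=
  exists m c, 0 < m /\ forall st x, st 0 = enc x ->
    reaches c st (fun t st' =>
      [/\ st' 0 = enc (f x), t <= T x & forall y, m <= y -> st' y = st y]).
Arguments computes {A B EA EB} f T.

Definition ptime A B (EA : encodable A) (EB : encodable B) (f : A -> B) :=
  exists2 T, computes f T & pbound esize T.
Arguments ptime {A B EA EB} f.

Lemma computes_esize A B (EA : encodable A) (EB : encodable B) (f : A -> B) T x :
  computes f T -> esize (f x) <= esize x + T x.
Proof.
case=> m [c [_ H]]; have [t [st [Hc [E Ht _]]]] := H (fun=> enc x) x erefl.
by have := exec_tsize 0 Hc; rewrite E /esize /=; lia.
Qed.

Lemma ptime_esize A B (EA : encodable A) (EB : encodable B) (f : A -> B) :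
  ptime f -> pbound esize (fun x => esize (f x)).
Proof.
case=> T H HT; apply: (@pbound_le _ _ _ (fun x => esize x + T x)); last by pbound_tac.
by move=> x; apply: computes_esize.
Qed.

Lemma eq_computes A B (EA : encodable A) (EB : encodable B) (f g : A -> B) T :
  f =1 g -> computes f T -> computes g T.
Proof.
move=> fg [m [c [m0 H]]]; exists m, c; split=> // st x sx.
by apply: (reaches_mono (H _ _ sx)) => t st'; rewrite fg.
Qed.

Lemma eq_ptime A B (EA : encodable A) (EB : encodable B) (f g : A -> B) :
  f =1 g -> ptime f -> ptime g.
Proof. by move=> fg [T H HT]; exists T => //; apply: eq_computes H. Qed.

Lemma computes_comp A B C (EA : encodable A) (EB : encodable B) (EC : encodable C)
    (f : A -> B) (g : B -> C) F G :
  computes f F -> computes g G -> computes (g \o f) (fun x => F x + G (f x)).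
Proof.
case=> mf [cf [mf0 Hf]] [mg [cg [mg0 Hg]]].
exists (maxn mf mg), (CSeq cf cg); split=> [|st x sx]; first by lia.
apply: reaches_seq; apply: (reaches_mono (Hf _ _ sx)) => t1 st1 [s1 le1 fr1].
apply: (reaches_mono (Hg _ _ s1)) => t2 st2 [s2 le2 fr2].
split=> // [|y hy]; first by lia.
by rewrite fr2 ?fr1 //; lia.
Qed.

Lemma ptime_comp A B C (EA : encodable A) (EB : encodable B) (EC : encodable C)
    (f : A -> B) (g : B -> C) : ptime g -> ptime f -> ptime (fun x => g (f x)).
Proof.
move=> [G Hg pG] Pf; have [F Hf pF] := Pf; exists (fun x => F x + G (f x)); first exact: computes_comp.
by apply: pbound_add => //; apply: (pbound_comp pG); apply: ptime_esize.
Qed.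

Lemma ptime_expr A B (EA : encodable A) (EB : encodable B) (f : A -> B) e T :
  (forall st x, st 0 = enc x -> eval st e = enc (f x) /\ ecost st e <= T x) ->
  pbound esize T -> ptime f.
Proof.
move=> He pT; exists T => //; exists 1, (CAssign 0 e); split=> // st x sx.
have [Ev Ec] := He _ _ sx; apply: reaches_assign; split=> //.
by case.
Qed.

(* Values with the same code are converted into each other by a copy. *)
Lemma ptime_recode A B (EA : encodable A) (EB : encodable B) (f : A -> B) :
  (forall x, enc (f x) = enc x) -> ptime f.
Proof.
move=> fE; apply: (@ptime_expr _ _ _ _ _ (EVar 0) esize); last by pbound_tac.
by move=> st x /= ->; rewrite fE /esize addn0.
Qed.

Lemma ptime_id A (EA : encodable A) : ptime (fun x : A => x).
Proof. exact: ptime_recode. Qed.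

Fixpoint quote (a : tree) : expr :=
  if a is Node a1 a2 then ENode (quote a1) (quote a2) else ELeaf.

Lemma quoteE st a : eval st (quote a) = a.
Proof. by elim: a => //= a1 -> a2 ->. Qed.

Lemma ecost_quote st st' a : ecost st (quote a) = ecost st' (quote a).
Proof. by elim: a => //= a1 -> a2 ->; rewrite !quoteE. Qed.

Lemma ptime_const A B (EA : encodable A) (EB : encodable B) (b : B) : ptime (fun _ : A => b).
Proof.
apply: (@ptime_expr _ _ _ _ _ (quote (enc b)) (fun=> ecost (fun=> Leaf) (quote (enc b)))).
  by move=> st x _; rewrite quoteE (ecost_quote _ (fun=> Leaf)).
exact: pbound_const.
Qed.

Lemma ptime_fst A B C (EA : encodable A) (EB : encodable B) (EC : encodable C)
  (f : A -> B * C) : ptime f -> ptime (fun x => (f x).1).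
Proof.
apply: ptime_comp; apply: (@ptime_expr _ _ _ _ _ (EHd (EVar 0)) (fun x => 2 * esize x)).
  by move=> st x /= ->; rewrite /esize; split=> //=; lia.
by pbound_tac.
Qed.

Lemma ptime_snd A B C (EA : encodable A) (EB : encodable B) (EC : encodable C)
  (f : A -> B * C) : ptime f -> ptime (fun x => (f x).2).
Proof.
apply: ptime_comp; apply: (@ptime_expr _ _ _ _ _ (ETl (EVar 0)) (fun x => 2 * esize x)).
  by move=> st x /= ->; rewrite /esize; split=> //=; lia.
by pbound_tac.
Qed.

Ltac store_tac := rewrite /update /=; repeat (case: eqP => //=; try lia; move=> _).

Lemma ptime_pair A B C (EA : encodable A) (EB : encodable B) (EC : encodable C)
  (f : A -> B) (g : A -> C) : ptime f -> ptime g -> ptime (fun x => (f x, g x)).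
Proof.
move=> Pf Pg; have [F [mf [cf [mf0 Hf]]] pF] := Pf; have [G [mg [cg [mg0 Hg]]] pG] := Pg.
have [sf sg] := (ptime_esize Pf, ptime_esize Pg).
exists (fun x => F x + G x + 3 * (esize x + esize (f x) + esize (g x) + 1)); last by pbound_tac.
(* Variables [m] and [m.+1] lie outside both frames: the first keeps the input, the second the value
   of [f] while [g] is computed. *)
pose m := maxn mf mg.
exists m.+2, (CSeq (CAssign m (EVar 0)) (CSeq cf (CSeq (CAssign m.+1 (EVar 0))
  (CSeq (CAssign 0 (EVar m)) (CSeq cg (CAssign 0 (ENode (EVar m.+1) (EVar 0)))))))).
split=> // st x sx; apply/reaches_seq/reaches_assign/reaches_seq => /=.
apply: (reaches_mono (Hf _ x _)) => [|t1 st1 [s1 le1 fr1]]; first by store_tac.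
apply/reaches_seq/reaches_assign/reaches_seq/reaches_assign/reaches_seq => /=.
apply: (reaches_mono (Hg _ x _)) => [|t2 st2 [s2 le2 fr2]].
  store_tac; rewrite fr1 ?leq_maxl //; store_tac.
apply/reaches_assign => /=.
have E1 : st2 m.+1 = enc (f x) by rewrite fr2 ?s1; [store_tac | lia].
have E2 : st1 m = enc x by rewrite fr1 ?leq_maxl //; store_tac.
split=> [||y hy].
- by store_tac; rewrite E1 s2.
- rewrite E1 s2 sx s1 /update /=; case: eqP => [|_]; first lia.
  by rewrite E2 /esize; lia.
- rewrite /update; case: eqP => [|_]; first lia.
  rewrite fr2; last by lia.
  rewrite /update; do 2! (case: eqP => [|_]; first lia).
  rewrite fr1; last by lia.
  by rewrite /update; case: eqP => [|_]; first lia.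
Qed.

Lemma ptime_comp2 A B C D (EA : encodable A) (EB : encodable B) (EC : encodable C)
    (ED : encodable D) (h : B -> C -> D) (f : A -> B) (g : A -> C) :
  ptime (fun p => h p.1 p.2) -> ptime f -> ptime g -> ptime (fun x => h (f x) (g x)).
Proof. by move=> Ph Pf Pg; apply: (ptime_comp Ph (ptime_pair Pf Pg)). Qed.

Lemma ptime_if A B (EA : encodable A) (EB : encodable B) (b : A -> bool) (f g : A -> B) :
  ptime b -> ptime f -> ptime g -> ptime (fun x => if b x then f x else g x).
Proof.
move=> Pb [F [mf [cf [mf0 Hf]]] pF] [G [mg [cg [mg0 Hg]]] pG].
have [H [mh [ch [mh0 Hh]]] pH] := Pb.
exists (fun x => H x + F x + G x + 4 * (esize x + 6)); last by pbound_tac.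
pose m := maxn mh (maxn mf mg).
exists m.+2, (CSeq (CAssign m (EVar 0)) (CSeq ch (CSeq (CAssign m.+1 (EVar 0))
  (CSeq (CAssign 0 (EVar m)) (CIf (EVar m.+1) cf cg))))).
split=> // st x sx; apply/reaches_seq/reaches_assign/reaches_seq => /=.
apply: (reaches_mono (Hh _ x _)) => [|t1 st1 [s1 le1 fr1]]; first by store_tac.
have E2 : st1 m = enc x by rewrite fr1 ?leq_maxl //; store_tac.
apply/reaches_seq/reaches_assign/reaches_seq/reaches_assign/reaches_if => /=.
set st2 := update _ 0 _.
have s20 : st2 0 = enc x by rewrite /st2; store_tac.
have -> : st2 m.+1 = enc (b x) by rewrite /st2 s1; store_tac.
have frame y : m.+1 < y -> st2 y = st y.
  move=> hy; rewrite /st2 /update; do 2! (case: eqP => [|_]; first lia).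
  rewrite fr1; last by lia.
  by rewrite /update; case: eqP => [|_]; first lia.
have cost : tsize (update st1 m.+1 (st1 0) m) = esize x.
  by rewrite /update; case: eqP => [|_]; first lia; rewrite E2.
have sb := esize_bool (b x).
have -> : is_node (enc (b x)) = b x by case: (b x).
rewrite cost sx s1; rewrite /esize in sb *.
case: (b x) sb => sb.
  apply: (reaches_mono (Hf _ x s20)) => t2 st3 [s3 le3 fr3]; split=> // [|y hy].
    by rewrite /esize; lia.
  by rewrite fr3 ?frame //; lia.
apply: (reaches_mono (Hg _ x s20)) => t2 st3 [s3 le3 fr3]; split=> // [|y hy].
  by rewrite /esize; lia.
by rewrite fr3 ?frame //; lia.
Qed.

(** Values are compared through their codes, which is why encodings are required to be injective. *)
Lemma ptime_eq A (B : eqType) (EA : encodable A) (EB : encodable B) (f g : A -> B) :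
  ptime f -> ptime g -> ptime (fun x => f x == g x).
Proof.
apply: (@ptime_comp2 _ _ _ _ _ _ _ _ (fun a b : B => a == b)).
apply: (@ptime_expr _ _ _ _ _ (EEq (EHd (EVar 0)) (ETl (EVar 0))) (fun x => 3 + 4 * esize x)).
  move=> st [x y] /= ->; rewrite /esize /=; split.
    by congr tree_of_bool; apply/tree_eqbP/eqP => [|->] //; apply: (@enc_inj _ EB).
  by case: tree_eqb => /=; lia.
by pbound_tac.
Qed.

(** Variable [m] holds the rest of the list, [m.+1] the environment and [m.+2] the accumulator. The
    bound [b] on all intermediate accumulators is assumed because iterating a polynomial-time step
    can produce huge values; [12 * b] pays for the bookkeeping of one round. *)
Lemma reaches_foldl T A E (ET : encodable T) (EA : encodable A) (EE : encodable E)
    (s : T * (A * E) -> A) m c F (b d : nat) (e : E) l a st :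
  0 < m ->
  (forall st x, st 0 = enc x -> reaches c st (fun t st' =>
      [/\ st' 0 = enc (s x), t <= F x & forall y, m <= y -> st' y = st y])) ->
  (forall x, F x <= (esize x).+2 ^ d) ->
  let step := fun a x => s (x, (a, e)) in
  (forall l1 l2, l = l1 ++ l2 -> esize (foldl step a l1) + esize l + esize e <= b) ->
  st m = enc l -> st m.+1 = enc e -> st m.+2 = enc a ->
  reaches (CWhile (EVar m) (CSeq (CAssign 0 (ENode (EHd (EVar m)) (ENode (EVar m.+2) (EVar m.+1))))
    (CSeq c (CSeq (CAssign m.+2 (EVar 0)) (CAssign m (ETl (EVar m))))))) st
  (fun t st' => [/\ st' m.+2 = enc (foldl step a l), t <= (size l).+1 * (b.+2 ^ d + 12 * b)
    & forall y, m.+2 < y -> st' y = st y]).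
Proof.
move=> m0 Hc HF step; elim: l a st => [|x l IH] a st Hb sl se sa.
  apply: reaches_stop => /=; rewrite sl //=; split=> //.
  by have := Hb [::] [::] erefl; have := tsize_gt0 (enc e); rewrite /esize; lia.
have b0 := Hb [::] _ erefl; rewrite [foldl _ _ _]/= esize_cons in b0.
have [x0 l0] := (tsize_gt0 (enc x), tsize_gt0 (enc l)).
apply: reaches_loop; rewrite /= sl //; apply/reaches_seq/reaches_assign/reaches_seq => /=.
apply: (reaches_mono (Hc _ (x, (a, e)) _)) => [|t1 st1 [s1 le1 fr1]].
  by rewrite /update eqxx sl se sa.
apply/reaches_seq/reaches_assign/reaches_assign => /=.
have fr y : m.+2 < y -> st1 y = st y.
  by move=> hy; rewrite fr1; [rewrite /update; case: eqP => [|_ //]; lia | lia].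
have E1 : st1 m = enc (x :: l) by rewrite fr1 //; store_tac.
have E2 : st1 m.+1 = enc e by rewrite fr1 //; store_tac.
set st2 := update _ m _.
apply: (reaches_mono (IH (step a x) st2 _ _ _ _)) => [l1 l2 El||||t3 st3 [s3 le3 fr3]].
- by have := Hb (x :: l1) l2; rewrite El /= => /(_ erefl); rewrite esize_cons; lia.
- by rewrite /st2 /update /= eqxx; case: eqP => [|_]; [lia | rewrite E1].
- by rewrite /st2 /update /= -E2; do 2! (case: eqP => [|_]; first lia).
- by rewrite /st2 /update /= -s1 eqxx; case: eqP => [|_]; first lia.
split=> // [|y hy]; last first.
  by rewrite fr3 // /st2 /update; do 2! (case: eqP => [|_]; first lia); rewrite fr.
have E3 : update st1 m.+2 (st1 0) m = enc (x :: l).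
  by rewrite -E1 /update; case: eqP => [|_]; first lia.
have b1 := Hb [:: x] l erefl; rewrite /= -/(step a x) esize_cons in b1.
have le1' : t1 <= b.+2 ^ d.
  apply: leq_trans le1 _; apply: leq_trans (HF _) _.
  case: (d) => // d'; rewrite leq_exp2r // !esize_pair /esize /= in b0 x0 l0 *; lia.
rewrite E3 s1 sl sa se /=; rewrite /esize /= in b0 b1 x0 l0 *.
rewrite [(size l).+2 * _]mulSn; move: ((size l).+1 * _) le3 => Z le3; move: (_ ^ _) le1' => Y le1'; rewrite /step in b1; lia.
Qed.

Lemma size_lt_esize T {ET : encodable T} (l : seq T) : size l < esize l.
Proof. by elim: l => // x l IH; rewrite esize_cons /=; lia. Qed.

Definition foldl_esize T A {EA : encodable A} (step : A -> T -> A) a l :=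
  \max_(i < (size l).+1) esize (foldl step a (take i l)).

Lemma foldl_esizeP T A {EA : encodable A} (step : A -> T -> A) a l1 l2 :
  esize (foldl step a l1) <= foldl_esize step a (l1 ++ l2).
Proof.
have lt : size l1 < (size (l1 ++ l2)).+1 by rewrite size_cat; lia.
by rewrite /foldl_esize (bigD1 (Ordinal lt)) //= take_size_cat // leq_maxl.
Qed.

(** The time is measured by the largest accumulator that occurs. So loops whose values are not
    polynomial in the input are covered as well, such as the search tree and the computation of
    [K ^ k.+1]. *)
Lemma computes_foldl T A E (ET : encodable T) (EA : encodable A) (EE : encodable E)
    (s : T * (A * E) -> A) : ptime s ->
  exists D, computes (fun p : seq T * (A * E) => foldl (fun a x => s (x, (a, p.2.2))) p.2.1 p.1)
    (fun p => (foldl_esize (fun a x => s (x, (a, p.2.2))) p.2.1 p.1 + esize p).+2 ^ D).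
Proof.
case=> F [m [c [m0 Hc]]] [d HF]; exists (d + 8).
pose loop := CWhile (EVar m) (CSeq (CAssign 0 (ENode (EHd (EVar m)) (ENode (EVar m.+2) (EVar m.+1))))
    (CSeq c (CSeq (CAssign m.+2 (EVar 0)) (CAssign m (ETl (EVar m)))))).
exists m.+3, (CSeq (CAssign m (EHd (EVar 0))) (CSeq (CAssign m.+1 (ETl (ETl (EVar 0))))
  (CSeq (CAssign m.+2 (EHd (ETl (EVar 0)))) (CSeq loop (CAssign 0 (EVar m.+2)))))).
split=> // st [l [a e]] s0; do 3! apply/reaches_seq/reaches_assign => /=; apply/reaches_seq.
set st1 := update _ m.+2 _.
have E0 : update st m (if st 0 is Node a _ then a else Leaf) 0 = enc (l, (a, e)).
  by rewrite -s0 /update; case: eqP => [|_]; first lia.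
have E1 : update (update st m (if st 0 is Node a _ then a else Leaf)) m.+1 (enc e) 0 = enc (l, (a, e)).
  by rewrite -E0 {1}/update; case: eqP => [|_]; first lia.
set S := foldl_esize _ _ _; pose (b := S + esize (l, (a, e))).
have R := @reaches_foldl _ _ _ _ _ _ s m c F b d e l a st1 m0 Hc HF.
apply: (reaches_mono (R _ _ _ _))
  => [l1 l2 El||||t2 st2 [s2 le2 fr2]].
- have := @foldl_esizeP _ _ EA (fun a x => s (x, (a, e))) a l1 l2; rewrite -El -/S.
  rewrite /b !esize_pair /=; lia.
- by rewrite /st1 /update s0 eqxx; do 2! (case: eqP => [|_]; first lia).
- by rewrite /st1 E0 /update /= eqxx; case: eqP => [|_]; first lia.
- by rewrite /st1 E0 /= E1 /update /= eqxx.
apply/reaches_assign => /=; split=> // [|y hy]; last first.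
  rewrite /update; case: eqP => [|_]; first lia.
  by rewrite fr2 // /st1 /update; do 3! (case: eqP => [|_]; first lia).
have HL := @foldl_esizeP _ _ EA (fun a x => s (x, (a, e))) a l [::]; rewrite cats0 -/S in HL.
have sb := @size_lt_esize _ ET l.
have bE : b = S + (esize l + (esize a + esize e).+1).+1 by [].
rewrite s2 E0 /= E1 s0 /= -/b; rewrite /esize /= in HL sb bE *.
have HK : (size l).+1 * (b.+2 ^ d + 12 * b) <= b.+2 * (b.+2 ^ d + 12 * b).
  by rewrite leq_mul2r; apply/orP; right; lia.
have d0 : 0 < b.+2 ^ d by rewrite expn_gt0.
have -> : b.+2 ^ (d + 8) = b.+2 ^ d * b.+2 ^ 8 by rewrite expnD.
(* Two of the eight extra factors pay for the number of rounds and the linear overhead, the other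
   six for the constants. *)
have H8 : 20 * (b.+2 * b.+2) <= b.+2 ^ 8.
  rewrite mulnn -[8]/(6 + 2) expnD leq_mul2r; apply/orP; right.
  by apply: (@leq_trans (2 ^ 6)) => //; rewrite leq_exp2r.
move: {bE} (b.+2 ^ d) (b.+2 ^ 8) d0 HK H8 le2 bE => X Y d0 HK H8 le2 bE.
have : 20 * (b.+2 * b.+2) * X <= X * Y by rewrite mulnC leq_mul2l H8 orbT.
nia.
Qed.

Lemma leq_exp2rW a b d : a <= b -> a ^ d <= b ^ d.
Proof. by case: d => // d; rewrite leq_exp2r. Qed.

Lemma ptime_foldl T A E (ET : encodable T) (EA : encodable A) (EE : encodable E)
    (s : E -> A -> T -> A) (l : E -> seq T) (a : E -> A) :
  ptime (fun p : T * (A * E) => s p.2.2 p.2.1 p.1) -> ptime l -> ptime a ->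
  (exists2 B, pbound esize B &
     forall x l1 l2, l x = l1 ++ l2 -> esize (foldl (s x) (a x) l1) <= B x) ->
  ptime (fun x => foldl (s x) (a x) (l x)).
Proof.
move=> Ps Pl Pa [B pB HB]; have [D HD] := computes_foldl Ps.
have Pq := ptime_pair Pl (ptime_pair Pa (ptime_id EE)); have [Q HQ pQ] := Pq.
eexists; first exact: computes_comp HQ HD.
apply: pbound_add => //=.
apply: (@pbound_le _ _ _ (fun x => (B x + esize (l x, (a x, x)) + 2) ^ D)) => [x|].
  apply: leq_exp2rW; rewrite addn2 !ltnS leq_add2r; apply/bigmax_leqP => i _.
  by apply: (HB x _ (drop i (l x))); rewrite cat_take_drop.
by have pe := ptime_esize Pq; pbound_tac.
Qed.

(** * Polynomial-time operations on lists and numbers *)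

Lemma ptime_copy A B C (EA : encodable A) (EB : encodable B) (EC : encodable C)
  (f : A -> B) (g : B -> C) : (forall y, enc (g y) = enc y) -> ptime f -> ptime (fun x => g (f x)).
Proof. by move/ptime_recode; apply: ptime_comp. Qed.

(** The predecessor of a number, the tail of a list and the inputs of a gate are all the right
    subtree of a code. *)
Lemma ptime_tail A B C (EA : encodable A) (EB : encodable B) (EC : encodable C)
    (f : A -> B) (g : B -> C) :
  (forall y, enc (g y) = if enc y is Node _ b then b else Leaf) ->
  ptime f -> ptime (fun x => g (f x)).
Proof.
move=> gE; apply: ptime_comp.
apply: (@ptime_expr _ _ _ _ _ (ETl (EVar 0)) (fun x => 2 * esize x)); last by pbound_tac.
move=> st y /= ->; rewrite gE; split=> //; rewrite /esize.
by case: (enc y) => //= *; lia.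
Qed.

Section ListConstructors.
Variables (X A B : Type) (EX : encodable X) (EA : encodable A) (EB : encodable B).

Lemma ptime_succn (f : X -> nat) : ptime f -> ptime (fun x => (f x).+1).
Proof.
move=> Pf; apply: (@ptime_copy _ _ _ _ _ _ (fun x => (tt, f x)) (fun p => p.2.+1)) => [[[] n]|] //.
by apply: ptime_pair => //; apply: ptime_const.
Qed.

Lemma ptime_predn (f : X -> nat) : ptime f -> ptime (fun x => (f x).-1).
Proof. by apply: ptime_tail; case. Qed.

Lemma ptime_cons (f : X -> A) s : ptime f -> ptime s -> ptime (fun x => f x :: s x).
Proof.
move=> Pf Ps; apply: (@ptime_copy _ _ _ _ _ _ (fun x => (f x, s x)) (fun p => p.1 :: p.2)) => //.
exact: ptime_pair.
Qed.

Lemma ptime_behead (s : X -> seq A) : ptime s -> ptime (fun x => behead (s x)).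
Proof. by apply: ptime_tail; case. Qed.

Lemma ptime_nseq (f : X -> nat) : ptime f -> ptime (fun x => nseq (f x) tt).
Proof. by apply: (@ptime_copy _ _ _ _ _ _ f (nseq^~ tt)); elim=> //= n <-. Qed.

Lemma ptime_nilp (s : X -> seq A) : ptime s -> ptime (fun x => nilp (s x)).
Proof.
apply: ptime_comp; apply: (@ptime_expr _ _ _ _ _ (EEq (EVar 0) ELeaf) (fun x => 4 + esize x)).
  move=> st l /= ->; split; first by case: l.
  by rewrite /esize; case: tree_eqb => /=; lia.
by pbound_tac.
Qed.

End ListConstructors.

Section ListSearch.
Variables (X A B : Type) (EX : encodable X) (EA : encodable A) (EB : encodable B).

Lemma ptime_head a (s : X -> seq A) : ptime s -> ptime (fun x => head a (s x)).
Proof.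
(* On the code of an empty list, [EHd] returns a leaf and not the code of the default [a]; so the
   list is padded before its head is taken. *)
move=> Ps; have Pd : ptime (fun x => if nilp (s x) then [:: a] else s x).
  by apply: ptime_if => //; [apply: ptime_nilp | apply: ptime_const].
apply: (@eq_ptime _ _ _ _ (fun x => head a (if nilp (s x) then [:: a] else s x))).
  by move=> x; case: (s x).
case: Pd => F [m [c [m0 Hc]]] pF; exists (fun x => F x + 2 * esize (if nilp (s x) then [:: a] else s x)).
  exists m, (CSeq c (CAssign 0 (EHd (EVar 0)))); split=> // st x /Hc Hx.
  apply/reaches_seq; apply: (reaches_mono Hx) => t st' [s0 le fr].
  apply/reaches_assign; rewrite /= s0 /esize; split=> [||y hy]; first by case: (s x).
    by case: (s x) => [|b l] /=; lia.
  by rewrite /update; case: eqP => [|_]; [lia | apply: fr].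
apply: pbound_add => //; apply: pbound_mul; first exact: pbound_const.
apply/ptime_esize/ptime_if; [exact: ptime_nilp | exact: ptime_const | by []].
Qed.

Lemma esize_catrev (s t : seq A) : (esize (catrev s t)).+1 = esize s + esize t.
Proof.
elim: s t => [|a s IH] t /=; first by rewrite /esize /=; lia.
by rewrite IH !esize_cons; lia.
Qed.

Lemma ptime_catrev (s t : X -> seq A) : ptime s -> ptime t -> ptime (fun x => catrev (s x) (t x)).
Proof.
move=> Ps Pt; apply: (@eq_ptime _ _ _ _ (fun x => foldl (fun r a => a :: r) (t x) (s x))).
  by move=> x; elim: (s x) (t x) => //= a l IH r; rewrite IH.
apply: ptime_foldl => //.
  apply: ptime_cons; [apply: ptime_fst; exact: ptime_id|].
  by apply/ptime_fst/ptime_snd/ptime_id.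
exists (fun x => esize (s x) + esize (t x)) => [|x l1 l2 ->].
  by apply: pbound_add; apply: ptime_esize.
have -> r : foldl (fun r a => a :: r) r l1 = catrev l1 r.
  by elim: l1 r => //= a l IH r; rewrite IH.
have := esize_catrev l1 (t x); have := esize_catrev (rev l1) l2.
by rewrite catrevE revK; have := esize_catrev l1 [::]; rewrite -/(rev l1) /esize /=; lia.
Qed.

Lemma ptime_rev (s : X -> seq A) : ptime s -> ptime (fun x => rev (s x)).
Proof. by move=> Ps; apply: ptime_catrev => //; apply: ptime_const. Qed.

Lemma ptime_has (l : X -> seq A) (p : X -> A -> bool) :
  ptime l -> ptime (fun q : A * X => p q.2 q.1) -> ptime (fun x => has (p x) (l x)).
Proof.
move=> Pl Pp; apply: (@eq_ptime _ _ _ _ (fun x => foldl (fun b a => if b then true else p x a) false (l x))).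
  move=> x; rewrite -[RHS]orFb; elim: (l x) false => //= [[]|a s IH b] //.
  by rewrite IH orbA.
apply: ptime_foldl => //; [|exact: ptime_const|].
  apply: ptime_if; [by apply/ptime_fst/ptime_snd/ptime_id | exact: ptime_const |].
  apply: (@ptime_comp _ _ _ _ _ _ (fun q : A * (bool * X) => (q.1, q.2.2)) (fun q => p q.2 q.1) Pp).
  by apply: ptime_pair; [apply/ptime_fst/ptime_id | apply/ptime_snd/ptime_snd/ptime_id].
by exists (fun=> 3); [exact: pbound_const | move=> *; apply: esize_bool].
Qed.

Lemma ptime_negb (b : X -> bool) : ptime b -> ptime (fun x => ~~ b x).
Proof. by move=> Pb; apply: ptime_if => //; apply: ptime_const. Qed.

Lemma ptime_andb (b c : X -> bool) : ptime b -> ptime c -> ptime (fun x => b x && c x).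
Proof. by move=> Pb Pc; apply: ptime_if => //; apply: ptime_const. Qed.

Lemma ptime_orb (b c : X -> bool) : ptime b -> ptime c -> ptime (fun x => b x || c x).
Proof. by move=> Pb Pc; apply: ptime_if => //; apply: ptime_const. Qed.

End ListSearch.

Section ListMaps.
Variables (X A B : Type) (EX : encodable X) (EA : encodable A) (EB : encodable B).

Lemma ptime_all (l : X -> seq A) (p : X -> A -> bool) :
  ptime l -> ptime (fun q : A * X => p q.2 q.1) -> ptime (fun x => all (p x) (l x)).
Proof.
move=> Pl Pp; apply: (@eq_ptime _ _ _ _ (fun x => ~~ has (fun a => ~~ p x a) (l x))).
  by move=> x; rewrite -all_predC; apply: eq_all => a /=; rewrite negbK.
by apply/ptime_negb/ptime_has => //; apply: ptime_negb.
Qed.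

Lemma ptime_cat (s t : X -> seq A) : ptime s -> ptime t -> ptime (fun x => s x ++ t x).
Proof.
move=> Ps Pt; apply: (@eq_ptime _ _ _ _ (fun x => catrev (rev (s x)) (t x))).
  by move=> x; rewrite catrevE revK.
by apply: ptime_catrev => //; apply: ptime_rev.
Qed.

Lemma esize_foldl_cons (h : A -> B) K l1 l2 s :
  (forall a, esize a < esize (l1 ++ l2) -> esize (h a) <= K) ->
  esize (foldl (fun s a => h a :: s) s l1) <= esize s + size l1 * K.+1.
Proof.
elim: l1 s => [|a l1 IH] s Hh /=; first by lia.
have/IH Hl b : esize b < esize (l1 ++ l2) -> esize (h b) <= K.
  by move=> hb; apply: Hh; rewrite /= esize_cons; lia.
have ha : esize (h a) <= K by apply: Hh; rewrite /= esize_cons; lia.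
by apply: leq_trans (Hl _) _; rewrite esize_cons mulSn; lia.
Qed.

Lemma ptime_map (l : X -> seq A) (g : X -> A -> B) :
  ptime l -> ptime (fun q : A * X => g q.2 q.1) -> ptime (fun x => map (g x) (l x)).
Proof.
move=> Pl Pg.
apply: (@eq_ptime _ _ _ _ (fun x => rev (foldl (fun s a => g x a :: s) [::] (l x)))).
  move=> x; have -> s : foldl (fun s a => g x a :: s) s (l x) = catrev (map (g x) (l x)) s.
    by elim: (l x) s => //= a t IH s; rewrite IH.
  by rewrite -[catrev _ _]/(rev _) revK.
apply/ptime_rev/ptime_foldl => //; [|exact: ptime_const|].
  apply: ptime_cons; last by apply/ptime_fst/ptime_snd/ptime_id.
  apply: (@ptime_comp _ _ _ _ _ _ (fun q : A * (seq B * X) => (q.1, q.2.2)) (fun q => g q.2 q.1) Pg).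
  by apply: ptime_pair; [apply/ptime_fst/ptime_id | apply/ptime_snd/ptime_snd/ptime_id].
have [d Hd] := ptime_esize Pg.
exists (fun x => 1 + esize (l x) * ((esize (l x) + esize x + 2) ^ d + 1)) => [|x l1 l2 El].
  by have pl := ptime_esize Pl; pbound_tac.
apply: leq_trans (@esize_foldl_cons (g x) ((esize (l x) + esize x + 2) ^ d) l1 l2 _ _) _.
  move=> a; rewrite -El => ha; apply: leq_trans (Hd (a, x)) _; apply: leq_exp2rW.
  by rewrite esize_pair /=; lia.
rewrite /= leq_add2l addn1 leq_mul2r; apply/orP; right.
by have := @size_lt_esize _ EA (l x); rewrite El size_cat; lia.
Qed.

Lemma ptime_flatten (l : X -> seq (seq A)) : ptime l -> ptime (fun x => flatten (l x)).
Proof.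
move=> Pl; apply: (@eq_ptime _ _ _ _ (fun x => rev (foldl (fun s t => catrev t s) [::] (l x)))).
  move=> x; have -> s : foldl (fun s t => catrev t s) s (l x) = catrev (flatten (l x)) s.
    by elim: (l x) s => //= a t IH s; rewrite IH !catrevE rev_cat catA.
  by rewrite -[catrev _ _]/(rev _) revK.
apply/ptime_rev/ptime_foldl => //; [|exact: ptime_const|].
  by apply: ptime_catrev; [apply/ptime_fst/ptime_id | apply/ptime_fst/ptime_snd/ptime_id].
exists (fun x => 1 + esize (l x)) => [|x l1 l2 ->]; first by have pl := ptime_esize Pl; pbound_tac.
have H s : esize (foldl (fun s t => catrev t s) s l1) <= esize s + esize (l1 ++ l2).
  elim: l1 s => [|a l1 IH] s /=; first by lia.
  by apply: leq_trans (IH _) _; have := @esize_catrev _ EA a s; rewrite esize_cons; lia.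
exact: H.
Qed.

End ListMaps.

Section ListAccess.
Variables (X A B : Type) (EX : encodable X) (EA : encodable A) (EB : encodable B).

Lemma ptime_size (s : X -> seq A) : ptime s -> ptime (fun x => size (s x)).
Proof.
move=> Ps; have Pm : ptime (fun x => map (fun=> tt) (s x)) by apply: ptime_map => //; apply: ptime_const.
apply: (@eq_ptime _ _ _ _ (fun x => size (map (fun=> tt) (s x)))); first by move=> x; rewrite size_map.
by apply: (ptime_copy _ Pm); elim=> [|[] u] //= ->.
Qed.

Lemma ptime_filter (l : X -> seq A) (p : X -> A -> bool) :
  ptime l -> ptime (fun q : A * X => p q.2 q.1) -> ptime (fun x => filter (p x) (l x)).
Proof.
move=> Pl Pp.
apply: (@eq_ptime _ _ _ _ (fun x => flatten (map (fun a => if p x a then [:: a] else [::]) (l x)))).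
  by move=> x; elim: (l x) => //= a s ->; case: (p x a).
apply/ptime_flatten/ptime_map => //; apply: ptime_if => //; last exact: ptime_const.
by apply: ptime_cons; [apply/ptime_fst/ptime_id | exact: ptime_const].
Qed.

Lemma ptime_nth a (s : X -> seq A) (n : X -> nat) :
  ptime s -> ptime n -> ptime (fun x => nth a (s x) (n x)).
Proof.
move=> Ps Pn.
apply: (@eq_ptime _ _ _ _ (fun x => head a (foldl (fun s _ => behead s) (s x) (nseq (n x) tt)))).
  by move=> x; elim: (n x) (s x) => [|k IH] [|b t] //=; rewrite IH ?nth_nil.
apply/ptime_head/ptime_foldl => //; [by apply/ptime_behead/ptime_fst/ptime_snd/ptime_id | exact: ptime_nseq |].
exists (fun x => esize (s x)) => [|x l1 l2 _]; first exact: ptime_esize.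
elim: l1 (s x) => //= _ l1 IH t; apply: leq_trans (IH _) _.
by case: t => //= b t; rewrite esize_cons; lia.
Qed.

End ListAccess.

Section Arithmetic.
Variables (X : Type) (EX : encodable X).

Lemma ptime_subn (m n : X -> nat) : ptime m -> ptime n -> ptime (fun x => m x - n x).
Proof.
move=> Pm Pn.
apply: (@eq_ptime _ _ _ _ (fun x => foldl (fun k _ => k.-1) (m x) (nseq (n x) tt))).
  by move=> x; elim: (n x) (m x) => [|k IH] i /=; [rewrite subn0 | rewrite IH; lia].
apply: ptime_foldl => //; [by apply/ptime_predn/ptime_fst/ptime_snd/ptime_id | exact: ptime_nseq |].
exists (fun x => esize (m x)) => [|x l1 l2 _]; first exact: ptime_esize.
elim: l1 (m x) => //= _ l1 IH t; apply: leq_trans (IH _) _.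
by rewrite !esize_nat; lia.
Qed.

Lemma ptime_leq (m n : X -> nat) : ptime m -> ptime n -> ptime (fun x => m x <= n x).
Proof. by move=> Pm Pn; apply: ptime_eq; [apply: ptime_subn | apply: ptime_const]. Qed.

Lemma ptime_addn (m n : X -> nat) : ptime m -> ptime n -> ptime (fun x => m x + n x).
Proof.
move=> Pm Pn; apply: (@eq_ptime _ _ _ _ (fun x => size (nseq (m x) tt ++ nseq (n x) tt))).
  by move=> x; rewrite size_cat !size_nseq.
by apply: ptime_size; apply: ptime_cat; apply: ptime_nseq.
Qed.

Lemma ptime_mem (C : eqType) (EC : encodable C) (f : X -> C) (s : X -> seq C) :
  ptime f -> ptime s -> ptime (fun x => f x \in s x).
Proof.
move=> Pf Ps; apply: (@eq_ptime _ _ _ _ (fun x => has (fun c => c == f x) (s x))).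
  by move=> x; rewrite -has_pred1.
apply: ptime_has => //; apply: ptime_eq; first by apply/ptime_fst/ptime_id.
by apply: (ptime_comp Pf); apply/ptime_snd/ptime_id.
Qed.

Lemma ptime_muln (m n : X -> nat) :
  ptime m -> ptime n -> ptime (fun x => m x * n x).
Proof.
move=> Pm Pn.
apply: (@eq_ptime _ _ _ _ (fun x => size (flatten (map (fun=> nseq (n x) tt) (nseq (m x) tt))))).
  by move=> x; elim: (m x) => //= k IH; rewrite size_cat IH size_nseq mulSn.
apply/ptime_size/ptime_flatten/ptime_map; first exact: ptime_nseq.
by apply: ptime_nseq; apply: (ptime_comp Pn); apply/ptime_snd/ptime_id.
Qed.

Lemma ptime_iota (n : X -> nat) : ptime n -> ptime (fun x => iota 0 (n x)).
Proof.
move=> Pn.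
apply: (@eq_ptime _ _ _ _ (fun x => rev (foldl (fun s _ => size s :: s) [::] (nseq (n x) tt)))).
  move=> x; have -> : foldl (fun s _ => size s :: s) [::] (nseq (n x) tt) = rev (iota 0 (n x)).
    elim: (n x) => // k IH; rewrite -addn1 nseqD foldl_cat IH /= iotaD rev_cat /= size_rev.
    by rewrite size_iota add0n.
  by rewrite revK.
apply/ptime_rev/ptime_foldl; [|exact: ptime_nseq|exact: ptime_const|].
  by apply: ptime_cons; [apply: ptime_size|]; apply/ptime_fst/ptime_snd/ptime_id.
exists (fun x => 1 + n x * (2 * n x + 2)) => [|x l1 l2 El].
  have pn : pbound esize n.
    by apply: pbound_le (ptime_esize Pn) => x; rewrite esize_nat; lia.
  by pbound_tac.
have : size l1 <= n x by rewrite -(size_nseq (n x) tt) El size_cat leq_addr.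
move: (n x) => N {El}; have -> : foldl (fun s _ => size s :: s) [::] l1 = rev (iota 0 (size l1)).
  elim/last_ind: l1 => //= l1 u IH; rewrite -cats1 foldl_cat size_cat /= IH.
  by rewrite iotaD rev_cat /= size_rev size_iota.
move: (size l1) => k; elim: k => [|k IH] leN; first by rewrite /esize /=; lia.
rewrite -addn1 iotaD rev_cat /= esize_cons esize_nat add0n.
have : esize (rev (iota 0 k)) <= 1 + k * (2 * N + 2).
  move: {IH} k leN => k; elim: k => [|k IH] leN; first by rewrite /esize /=; lia.
  by rewrite -addn1 iotaD rev_cat /= esize_cons esize_nat add0n; have := IH (ltnW leN); nia.
nia.
Qed.

End Arithmetic.

(** * Syntax-directed proofs of polynomial running time *)

Ltac pt_extra := fail.
Ltac pt_step := cbv beta; first [ assumption | pt_extra | match goal with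
  | |- encodable _ => typeclasses eauto
  | |- ptime (@fst _ _) => apply: (ptime_fst (ptime_id _))
  | |- ptime (@snd _ _) => apply: (ptime_snd (ptime_id _))
  | |- ptime (fun x => x) => apply: ptime_id
  | |- ptime (fun _ => ?c) => exact: ptime_const
  | |- ptime (fun x => (@?f x).1) => apply: ptime_fst
  | |- ptime (fun x => (@?f x).2) => apply: ptime_snd
  | |- ptime (fun x => (@?f x, @?g x)) => apply: ptime_pair
  | |- ptime (fun x => ~~ @?f x) => apply: ptime_negb
  | |- ptime (fun x => @?f x && @?g x) => apply: ptime_andb
  | |- ptime (fun x => @?f x || @?g x) => apply: ptime_orb
  | |- ptime (fun x => @?f x == @?g x) => apply: ptime_eq
  | |- ptime (fun x => @?f x <= @?g x) => apply: ptime_leq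
  | |- ptime (fun x => (@?f x).+1) => apply: ptime_succn
  | |- ptime (fun x => (@?f x).-1) => apply: ptime_predn
  | |- ptime (fun x => @?f x + @?g x) => apply: ptime_addn
  | |- ptime (fun x => @?f x - @?g x) => apply: ptime_subn
  | |- ptime (fun x => @?f x * @?g x) => apply: ptime_muln
  | |- ptime (fun x => @?f x :: @?g x) => apply: ptime_cons
  | |- ptime (fun x => @?f x ++ @?g x) => apply: ptime_cat
  | |- ptime (fun x => rev (@?f x)) => apply: ptime_rev
  | |- ptime (fun x => size (@?f x)) => apply: ptime_size
  | |- ptime (fun x => nilp (@?f x)) => apply: ptime_nilp
  | |- ptime (fun x => head _ (@?f x)) => apply: ptime_head
  | |- ptime (fun x => nth _ (@?f x) (@?g x)) => apply: ptime_nth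
  | |- ptime (fun x => iota 0 (@?f x)) => apply: ptime_iota
  | |- ptime (fun x => nseq (@?f x) tt) => apply: ptime_nseq
  | |- ptime (fun x => flatten (@?f x)) => apply: ptime_flatten
  | |- ptime (fun x => @?f x \in (@?g x)) => apply: ptime_mem
  | |- ptime (fun x => map (@?g x) (@?f x)) => apply: ptime_map
  | |- ptime (fun x => filter (@?g x) (@?f x)) => apply: ptime_filter
  | |- ptime (fun x => has (@?g x) (@?f x)) => apply: ptime_has
  | |- ptime (fun x => all (@?g x) (@?f x)) => apply: ptime_all
  | H : ptime ?f |- ptime (fun x => ?f (@?g x)) => apply: (ptime_comp H)
  end | apply: ptime_if ].
Ltac pt := repeat pt_step.

(** Polynomial for constant [q]. Tuples of vertices, certificates, objections and terms are all
    drawn from such enumerations. *)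
Definition lists (A : Type) q (s : seq A) : seq (seq A) :=
  iter q (fun L => [::] :: [seq a :: l | a <- s, l <- L]) [:: [::]].

Lemma mem_lists (A : eqType) q (s l : seq A) :
  (l \in lists q s) = (size l <= q) && all (mem s) l.
Proof.
elim: q l => [|q IH] l; first by case: l.
rewrite /lists iterS -/(lists q s) inE; case: l => [|a l] //=.
apply/allpairsP/and3P => [[[b t] [/= hb]]|[ha hl1 hl2]].
  by rewrite IH => /andP[? ?] [-> ->].
by exists (a, l); split=> //=; rewrite IH hl2 andbT.
Qed.

Lemma ptime_lists X A (EX : encodable X) (EA : encodable A) q (s : X -> seq A) :
  ptime s -> ptime (fun x => lists q (s x)).
Proof.
move=> Ps; elim: q => [|q IH] /=; first by pt.
apply: ptime_cons; first by pt.
apply/ptime_flatten/ptime_map => //; apply: ptime_map; last by pt.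
by apply: (ptime_comp IH); pt.
Qed.

Definition dedup (A : eqType) (s : seq A) : seq A :=
  foldl (fun t a => if a \in t then t else a :: t) [::] s.

Lemma dedup_uniq_mem (A : eqType) (s : seq A) : uniq (dedup s) /\ dedup s =i s.
Proof.
rewrite /dedup; elim/last_ind: s => [|s a [U M]] //; rewrite -cats1 foldl_cat /=.
case: ifP => [ha|/negbT ha].
  split=> // b; rewrite mem_cat M inE; case: eqP => [->|_]; last by rewrite orbF.
  by rewrite -M ha.
by split=> [|b]; rewrite /= ?ha // inE M mem_cat inE orbC.
Qed.

Lemma ptime_dedup X (A : eqType) (EX : encodable X) (EA : encodable A) (s : X -> seq A) :
  ptime s -> ptime (fun x => dedup (s x)).
Proof.
move=> Ps; apply: ptime_foldl => //; [by pt | by pt |].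
exists (fun x => 1 + esize (s x)) => [|x l1 l2 ->]; first by have ps := ptime_esize Ps; pbound_tac.
have H t : esize (foldl (fun t a => if a \in t then t else a :: t) t l1) <= esize t + esize (l1 ++ l2).
  elim: l1 t => [|a l1 IH] t /=; first by lia.
  by apply: leq_trans (IH _) _; case: ifP => _; rewrite !esize_cons;
    move: (esize (l1 ++ l2)) (esize a) (esize t) => *; lia.
exact: H.
Qed.

Lemma ptime_expn X (EX : encodable X) (f : X -> nat) e : ptime f -> ptime (fun x => f x ^ e).
Proof.
move=> Pf; elim: e => [|e IH]; first by apply: (eq_ptime (fun x => esym (expn0 (f x)))); pt.
by apply: (eq_ptime (fun x => esym (expnS (f x) e))); pt.
Qed.

Definition gate_tag (g : gate) : nat :=
  match g with GIn => 0 | GNot _ => 1 | GAnd _ => 2 | GOr _ => 3 end.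

Lemma ptime_gate_tag X (EX : encodable X) (g : X -> gate) :
  ptime g -> ptime (fun x => gate_tag (g x)).
Proof.
apply: ptime_comp.
apply: (@ptime_expr _ _ _ _ _ (EHd (EVar 0)) (fun x => 2 * esize x)); last by pbound_tac.
move=> st y /= ->; rewrite /esize; case: y => [|i|s|s] /=; split=> //; lia.
Qed.

Lemma ptime_inputs X (EX : encodable X) (g : X -> gate) :
  ptime g -> ptime (fun x => inputs (g x)).
Proof. by apply: ptime_tail; case. Qed.

(** * Computable bounds, FPT membership and composition of reductions *)

Lemma computes_computable f T : computes f T -> computable f.
Proof.
case=> m [c [_ H]]; exists c => n.
have [t [st [Hc [E _ _]]]] := H (update (fun=> Leaf) 0 (tree_of_nat n)) n erefl.
by exists t; exists st.
Qed.

Lemma computable_comp f g T : computable f -> computes g T -> computable (g \o f).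
Proof.
case=> c Hc [m [c' [_ H]]]; exists (CSeq c c') => n.
have [t [st Hst st0]] := Hc n; have [t' [st' [Hst' [E _ _]]]] := H st (f n) st0.
by exists (t + t'), st' => //; apply: exec_seq Hst Hst'.
Qed.

Lemma computable_exp K : computable (fun k => K ^ k.+1).
Proof.
have Ps : ptime (fun q : unit * (nat * unit) => q.2.1 * K) by pt.
have [D HD] := computes_foldl Ps.
have [L HL _] : ptime (fun k => (nseq k tt, (K, tt))) by pt.
apply: (@computes_computable _ _ (eq_computes _ (computes_comp HL HD))) => k /=.
by rewrite expnS; elim: k {2 3}K => [|k IH] N /=; rewrite ?muln1 // IH expnS mulnA.
Qed.

Lemma FPT_computes (P : pproblem) A (EA : encodable A) (c : inst P -> A) (f : A -> bool) T K d :
  (forall x, code x = enc (c x)) -> computes f T ->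
  (forall x, T (c x) <= K ^ (param x).+1 * tsize (code x) ^ d) ->
  (forall x, f (c x) <-> yes x) -> FPT P.
Proof.
move=> codeE [m [p [_ Hp]]] HT Hf; exists p, (fun k => K ^ k.+1), d; split; first exact: computable_exp.
move=> x; have [t [st [Hst [E le _]]]] := Hp (update (fun=> Leaf) 0 (code x)) (c x) (codeE x).
exists (enc (f (c x))), t; split; first by exists st.
  exact: leq_trans le (HT x).
by rewrite -Hf; case: (f (c x)).
Qed.

Lemma fpt_reduces_ptime (Q P R : pproblem) A B (EA : encodable A) (EB : encodable B)
    (c : inst P -> A) (F : A -> B) b :
  (forall x, code x = enc (c x)) -> ptime F ->
  (forall x, exists y : inst R, [/\ code y = enc (F (c x)), param y <= param x + b & yes x <-> yes y]) ->
  fpt_reduces Q P -> fpt_reduces Q R.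
Proof.
move=> codeE [T [m [p [_ Hp]]] [e He]] HF [p1 [f [g [d [Cf Cg H]]]]].
exists (CSeq p1 p), (fun k => (f k + 3) ^ e.+2), (fun k => g k + b), (d.+1 * e.+2); split.
- have [L HL _] : ptime (fun i => (i + 3) ^ e.+2) by apply: ptime_expn; pt.
  exact: computable_comp Cf HL.
- have [L HL _] : ptime (fun i => i + b) by pt.
  exact: computable_comp Cg HL.
move=> x; have [y [t [[st Hst st0] Ht Hg Hy]]] := H x; have [z [codez Hz yz]] := HF y.
have [t' [st' [Hst' [E le _]]]] := Hp st (c y) (etrans st0 (codeE y)).
exists z, (t + t'); split; [ | | lia | by rewrite Hy].
  by exists st'; [apply: exec_seq Hst Hst' | rewrite E codez].
have sy : esize (c y) <= tsize (code x) + t.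
  by have := exec_tsize 0 Hst; rewrite st0 codeE /esize.
rewrite expnM -expnMn; have n0 := tsize_gt0 (code x); move: (tsize (code x)) (f _) n0 Ht sy => n fk n0 Ht sy.
have hd : 0 < n ^ d by rewrite expn_gt0 n0.
(* The right-hand side dominates the time of the first reduction and the size of its output. The
   total time is then bounded by its power [e.+2], whence the exponents chosen above. *)
have leX : t + n + 2 <= (fk + 3) * n ^ d.+1 by rewrite expnS; nia.
have X2 : 2 <= (fk + 3) * n ^ d.+1 by rewrite expnS; nia.
move: ((fk + 3) * _) leX X2 => X leX X2.
have le' : t' <= X ^ e.
  apply: leq_trans le _; apply: leq_trans (He _) _; apply: leq_exp2rW; lia.
have X1 : X ^ 1 <= X ^ e.+1 by rewrite leq_exp2l.
have X3 : X ^ e <= X ^ e.+1 by rewrite leq_exp2l.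
by rewrite expnS; rewrite expn1 in X1; nia.
Qed.

Lemma pbound_trans T (N M F : T -> nat) : pbound N F -> pbound M N -> pbound M F.
Proof. exact: (@pbound_comp T T id M N F). Qed.

(** * Evaluation of formulas on adjacency matrices *)

Definition matrix := seq (seq bool).

Fixpoint qf_eval (M : matrix) m (q : qf m) (e : seq nat) : bool :=
  match q with
  | Adj i j => nth false (nth [::] M (nth 0 e i)) (nth 0 e j)
  | Equal i j => nth 0 e i == nth 0 e j
  | Not q1 => ~~ qf_eval M q1 e
  | And q1 q2 => qf_eval M q1 e && qf_eval M q2 e
  | Or q1 q2 => qf_eval M q1 e || qf_eval M q2 e
  | Imp q1 q2 => ~~ qf_eval M q1 e || qf_eval M q2 e
  | Iff q1 q2 => qf_eval M q1 e == qf_eval M q2 e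
  end.

(** Quantifiers range over [V], so that deletion only shrinks [V], while the matrix and the vertex
    numbers stay those of the original graph. *)
Fixpoint fo_eval (M : matrix) (V : seq nat) m (phi : fo m) (e : seq nat) : bool :=
  match phi with
  | Matrix q => qf_eval M q e
  | Ex psi => has (fun v => fo_eval M V psi (v :: e)) V
  | All psi => all (fun v => fo_eval M V psi (v :: e)) V
  end.

Lemma ptime_qf_eval X (EX : encodable X) m (q : qf m) (M : X -> matrix) (e : X -> seq nat) :
  ptime M -> ptime e -> ptime (fun x => qf_eval (M x) q (e x)).
Proof. by move=> PM Pe; elim: q => * /=; pt. Qed.

Lemma ptime_fo_eval m (phi : fo m) X (EX : encodable X) (M : X -> matrix) (V : X -> seq nat)
    (e : X -> seq nat) :
  ptime M -> ptime V -> ptime e -> ptime (fun x => fo_eval (M x) (V x) phi (e x)).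
Proof.
elim: phi X EX M V e => {m} [m q|m phi IH|m phi IH] X EX M V e PM PV Pe /=.
- exact: ptime_qf_eval.
- by apply: ptime_has => //; apply: IH; pt.
- by apply: ptime_all => //; apply: IH; pt.
Qed.

Lemma qf_evalP (H : sgraph) (ix : vertex H -> nat) M m (q : qf m) (e : m.-tuple (vertex H)) :
  injective ix -> (forall u v, nth false (nth [::] M (ix u)) (ix v) = adj u v) ->
  qf_sat q e = qf_eval M q (map ix e).
Proof.
move=> inj HM; have nthE (i : 'I_m) : nth 0 (map ix e) i = ix (tnth e i).
  by rewrite -[LHS](tnth_nth 0 [tuple of map ix e]) tnth_map.
elim: q => [i j|i j|q IH|q IH r IH'|q IH r IH'|q IH r IH'|q IH r IH'] /=.
- by rewrite !nthE HM.
- by rewrite !nthE (inj_eq inj).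
- by rewrite IH.
- by rewrite IH IH'.
- by rewrite IH IH'.
- by rewrite IH IH' implybE.
- by rewrite IH IH'.
Qed.

Lemma fo_evalP (H : sgraph) (ix : vertex H -> nat) M V m (phi : fo m) (e : m.-tuple (vertex H)) :
  injective ix -> (forall u v, nth false (nth [::] M (ix u)) (ix v) = adj u v) ->
  (forall n, reflect (exists u, n = ix u) (n \in V)) ->
  sat phi e <-> fo_eval M V phi (map ix e).
Proof.
move=> inj HM HV; elim: phi e => {m} [m q|m phi IH|m phi IH] e /=.
- by rewrite (qf_evalP _ _ inj HM).
- split=> [[u /IH Hu]|/hasP[n /HV[u ->] Hu]]; last by exists u; apply/IH.
  by apply/hasP; exists (ix u) => //; apply/HV; exists u.
- split=> [Hu|/allP Hu u]; last by apply/IH/Hu/HV; exists u.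
  by apply/allP => n /HV[u ->]; have /IH := Hu u.
Qed.

Definition all_in (V x : seq nat) := all (mem V) x.

(** The block is described through [fo_eval], so the remaining formula keeps its own number of free
    variables. The outermost variable of the block comes last in [x], hence the use of [rcons]. *)
Lemma Sigma_block s m (phi : fo m) : Sigma s phi ->
  if s is s'.+1 then exists a m' (psi : fo m'), Pi s' psi /\ forall M V e,
    fo_eval M V phi e <-> exists x, [/\ size x = a, all_in V x & fo_eval M V psi (x ++ e)]
  else exists q, phi = Matrix q.
Proof.
elim=> {s m phi} [m q|s m phi Hphi|s m phi _ [a [m' [psi [Hpsi E]]]]].
- by exists q.
- exists 0, m, phi; split=> // M V e; split=> [H|[x [/size0nil->]]] //.
  by exists [::].
- exists a.+1, m', psi; split=> // M V e /=; split.
    case/hasP=> v Vv /E[x [sx Vx Hx]]; exists (rcons x v).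
    by rewrite size_rcons sx cat_rcons /all_in all_rcons /= Vv.
  case; case/lastP=> [[] //|x v]; rewrite size_rcons /all_in all_rcons cat_rcons.
  case=> [[sx] /andP[Vv Vx] Hx]; apply/hasP; exists v => //.
  by apply/E; exists x.
Qed.

Lemma Pi_block s m (phi : fo m) : Pi s phi ->
  if s is s'.+1 then exists b m' (psi : fo m'), Sigma s' psi /\ forall M V e,
    fo_eval M V phi e <-> forall y, size y = b -> all_in V y -> fo_eval M V psi (y ++ e)
  else exists q, phi = Matrix q.
Proof.
elim=> {s m phi} [m q|s m phi Hphi|s m phi _ [b [m' [psi [Hpsi E]]]]].
- by exists q.
- exists 0, m, phi; split=> // M V e; split=> [H y /size0nil->|H] //.
  exact: (H [::]).
- exists b.+1, m', psi; split=> // M V e /=; split.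
    move/allP=> H; case/lastP=> // y v; rewrite size_rcons /all_in all_rcons cat_rcons.
    by case=> sy /andP[Vv Vy]; have /E := H v Vv; apply.
  move=> H; apply/allP => v Vv; apply/E => y sy Vy; rewrite -cat_rcons.
  by apply: H; rewrite ?size_rcons ?sy // /all_in all_rcons /= Vv.
Qed.

(** The value of the quantifier-free part does not depend on the range of the quantifiers, so old
    witnesses remain valid. *)
Lemma Sigma1_mono m (phi : fo m) M V V' e : Sigma 1 phi -> {subset V <= V'} ->
  fo_eval M V phi e -> fo_eval M V' phi e.
Proof.
case/Sigma_block=> a [m' [psi [/Pi_block[q ->] E]]] sub /E[x [sx Vx Hx]].
by apply/E; exists x; split=> //; apply: sub_all Vx.
Qed.

(** * The bounded search tree *)

Section Search.
Variables (a b : nat) (m : nat) (chi : fo m).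

(* A search node [(x, S)] holds the values [x] of the outer existential block and the set [S] of
   vertices deleted so far. *)
Definition node := (seq nat * seq nat)%type.

Definition alive (M : matrix) (S : seq nat) := [seq v <- iota 0 (size M) | v \notin S].

Definition violations (M : matrix) (p : node) :=
  [seq y <- lists b (alive M p.2) |
     (size y == b) && ~~ fo_eval M (alive M p.2) chi (y ++ p.1)].

(** The vertices of [x] must survive as witnesses of the outer block; a violation inside [x]
    therefore leaves no successor. Nodes without violations are passed on, so that level [k] also
    contains the solutions with fewer deletions. *)
Definition branch (M : matrix) (p : node) : seq node :=
  if nilp (violations M p) then [:: p]
  else [seq (p.1, v :: p.2) | v <- [seq v <- head [::] (violations M p) | v \notin p.1]].

Definition start_nodes (M : matrix) : seq node :=
  [seq (x, [::]) | x <- [seq x <- lists a (iota 0 (size M)) | size x == a]].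

Definition level (M : matrix) (k : nat) : seq node :=
  iter k (fun L => flatten (map (branch M) L)) (start_nodes M).

Definition search (M : matrix) (k : nat) : bool :=
  has (fun p => nilp (violations M p)) (level M k).

Hypothesis chi_mono : forall M V V' e, {subset V <= V'} -> fo_eval M V chi e -> fo_eval M V' chi e.

Lemma violationsP M p : reflect
  (forall y, size y = b -> all_in (alive M p.2) y -> fo_eval M (alive M p.2) chi (y ++ p.1))
  (nilp (violations M p)).
Proof.
apply: (iffP nilP) => [E y sy Vy|H].
  apply: contraT => Hy; have : y \in violations M p.
    by rewrite mem_filter mem_lists sy eqxx leqnn Hy /=.
  by rewrite E.
case E: (violations M p) => [|y t] //.
have : y \in violations M p by rewrite E mem_head.
rewrite mem_filter mem_lists => /andP[/andP[/eqP sy Hy] /andP[_ Vy]].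
by rewrite H in Hy.
Qed.

Lemma mem_alive M S v : (v \in alive M S) = (v < size M) && (v \notin S).
Proof. by rewrite mem_filter mem_iota add0n andbC. Qed.

Lemma alive_eq M S S' : S =i S' -> alive M S = alive M S'.
Proof. by move=> E; apply: eq_filter => v; rewrite E. Qed.

Definition good_node M k (p : node) := [/\ size p.1 = a, all_in (alive M p.2) p.1,
  uniq p.2, size p.2 <= k & all (fun v => v < size M) p.2].

Lemma level_good M k p : p \in level M k -> good_node M k p.
Proof.
elim: k p => [|k IH] p.
  case/mapP=> x; rewrite mem_filter mem_lists => /andP[/eqP sx /andP[_ Vx]] ->; split=> //.
  by apply: sub_all Vx => v; rewrite /= mem_alive mem_iota andbT.
rewrite /level iterS -/(level M k) => /flattenP[t /mapP[q /IH[sx Vx uS sS lS] ->]].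
rewrite /branch; case: ifP => [_|/nilP].
  by rewrite inE => /eqP->; split=> //; apply: leqW.
case E: (violations M q) => [|y t'] // _ /mapP[v]; rewrite mem_filter /= => /andP[xv yv] ->.
have : y \in violations M q by rewrite E mem_head.
rewrite mem_filter mem_lists => /andP[_ /andP[_ /allP/(_ v yv)]].
rewrite /= mem_alive => /andP[lv Sv]; split=> //=; rewrite ?Sv ?lv //.
apply/allP => u xu; have := allP Vx u xu; rewrite /= !mem_alive inE negb_or => /andP[-> ->].
by rewrite andbT; apply: contraNneq xv => <-.
Qed.

(** Following a solution [S] down the tree, a violated [y] must meet [S]: otherwise the witnesses
    for [y] in the graph without [S] would, by monotonicity, also work in the larger graph without
    [p.2]. *)
Lemma level_complete M S x k : size x = a -> all_in (alive M S) x ->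
    (forall y, size y = b -> all_in (alive M S) y -> fo_eval M (alive M S) chi (y ++ x)) ->
  exists2 p, p \in level M k &
    [/\ p.1 = x, {subset p.2 <= S}, uniq p.2 & nilp (violations M p) || (size p.2 == k)].
Proof.
move=> sx Vx Hx; elim: k => [|k [p Lp [px pS pu Hp]]].
  exists (x, [::]); last by split=> //; rewrite orbT.
  apply/mapP; exists x => //; rewrite mem_filter mem_lists sx eqxx leqnn /=.
  by apply: sub_all Vx => v; rewrite /= mem_alive mem_iota => /andP[].
rewrite /level iterS -/(level M k); move: Hp; case nil_p: (nilp (violations M p)) => /= Hp.
  exists p; last by split=> //; rewrite nil_p.
  by apply/flattenP; exists [:: p]; [apply/mapP; exists p; rewrite // /branch nil_p | rewrite inE].
move/eqP: Hp nil_p => sp; case E: (violations M p) => [|y t] // _.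
have : y \in violations M p by rewrite E mem_head.
rewrite mem_filter mem_lists => /andP[/andP[/eqP sy Hy] /andP[_ Vy]].
have [v yv Sv] : exists2 v, v \in y & v \in S.
  apply/hasP; apply: contraR Hy => /hasPn yS; rewrite px; apply: (@chi_mono _ (alive M S)).
    by move=> v; rewrite !mem_alive => /andP[-> /=]; apply: contra => /pS.
  apply: Hx => //; apply/allP => v yv; have := allP Vy v yv.
  by rewrite /= !mem_alive => /andP[-> _]; apply: yS.
have := allP Vy v yv; rewrite /= mem_alive => /andP[lv pv].
exists (x, v :: p.2); last first.
  split=> //=; [by move=> u; rewrite inE => /predU1P[->|/pS] | by rewrite pv | by rewrite sp eqxx orbT].
apply/flattenP; exists (branch M p); first by apply/mapP; exists p.
rewrite /branch E /=; apply/mapP; exists v; last by rewrite px.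
(* The vertex [v] is in [S], while [x] avoids [S]; so this branch is not pruned. *)
rewrite mem_filter yv andbT px; apply/negP => /(allP Vx); rewrite /= mem_alive Sv.
by rewrite andbF.
Qed.

Lemma searchP M k : search M k <-> exists S,
  [/\ uniq S, all (fun v => v < size M) S, size S <= k & exists x, [/\ size x = a, all_in (alive M S) x &
    forall y, size y = b -> all_in (alive M S) y -> fo_eval M (alive M S) chi (y ++ x)]].
Proof.
split=> [/hasP[[x S] /level_good[sx Vx uS sS lS] /violationsP H]|[S [uS lS sS [x [sx Vx Hx]]]]].
  by exists S; split=> //; exists x.
have [p Lp [px pS pu Hp]] := level_complete k sx Vx Hx.
apply/hasP; exists p => //; case/orP: Hp => // /eqP sp; apply/violationsP.
(* Now [p.2] consists of [k] elements of [S], so it is all of [S], which has no violations. *)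
have [|_ eqS] := uniq_min_size pu pS; first by rewrite sp.
by rewrite (alive_eq _ eqS) px.
Qed.

End Search.

(** * Running time of the search tree *)

Section SearchCost.
Variables (a b : nat) (m : nat) (chi : fo m).

Lemma ptime_alive X (EX : encodable X) (M : X -> matrix) S :
  ptime M -> ptime S -> ptime (fun x => alive (M x) (S x)).
Proof. by move=> PM PS; rewrite /alive; pt. Qed.

Lemma ptime_violations X (EX : encodable X) (M : X -> matrix) (p : X -> node) :
  ptime M -> ptime p -> ptime (fun x => violations b chi (M x) (p x)).
Proof.
move=> PM Pp; apply: ptime_filter; first by apply/ptime_lists/ptime_alive; pt.
apply: ptime_andb; first by pt.
by apply/ptime_negb/ptime_fo_eval; [pt | apply: ptime_alive; pt | pt].
Qed.

Lemma ptime_branch X (EX : encodable X) (M : X -> matrix) (p : X -> node) :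
  ptime M -> ptime p -> ptime (fun x => branch b chi (M x) (p x)).
Proof. by move=> PM Pp; have Pv := ptime_violations PM Pp; rewrite /branch; pt. Qed.

Lemma ptime_start_nodes X (EX : encodable X) (M : X -> matrix) :
  ptime M -> ptime (fun x => start_nodes a (M x)).
Proof. by move=> PM; apply: ptime_map; last pt; apply: ptime_filter; [apply: ptime_lists|]; pt. Qed.

Lemma esize_seq_le A (EA : encodable A) (s : seq A) K :
  (forall x, List.In x s -> esize x <= K) -> esize s <= 1 + size s * K.+1.
Proof.
elim: s => [|x s IH] H; first by rewrite /esize /=; lia.
have hx : esize x <= K by apply: H; left.
have hs : esize s <= 1 + size s * K.+1 by apply: IH => y ys; apply: H; right.
by rewrite esize_cons /= mulSn; lia.
Qed.

(** The additional one is for a node that is passed on, as [b] may be 0. *)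
Lemma size_branch M p : size (branch b chi M p) <= b.+1.
Proof.
rewrite /branch; case: ifP => // /nilP; case E: (violations b chi M p) => [|y t] // _.
rewrite size_map size_filter; apply: leq_trans (count_size _ _) _ => /=.
have : y \in violations b chi M p by rewrite E mem_head.
by rewrite mem_filter => /andP[/andP[/eqP-> _] _].
Qed.

Lemma esize_branch M p q : q \in branch b chi M p -> esize q <= esize p + 2 * esize M.
Proof.
rewrite /branch; case: ifP => [_|/nilP]; first by rewrite inE => /eqP->; apply: leq_addr.
case E: (violations b chi M p) => [|y t] // _ /mapP[v]; rewrite mem_filter /= => /andP[_ yv] ->.
have : y \in violations b chi M p by rewrite E mem_head.
rewrite mem_filter mem_lists => /andP[_ /andP[_ /allP/(_ v yv)]].
rewrite /= mem_alive => /andP[lv _]; have sM : size M < esize M by apply: size_lt_esize.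
by rewrite !esize_pair /= esize_cons esize_nat; lia.
Qed.

Lemma size_level M k : size (level a b chi M k) <= size (start_nodes a M) * b.+1 ^ k.
Proof.
elim: k => [|k IH]; first by rewrite expn0 muln1.
rewrite /level iterS -/(level a b chi M k) expnS.
have H (L : seq node) : size (flatten (map (branch b chi M) L)) <= size L * b.+1.
  elim: L => //= p L IHL; rewrite size_cat mulSn leq_add //; exact: size_branch.
by apply: leq_trans (H _) _; rewrite mulnCA [X in _ <= X]mulnC leq_mul2r IH orbT.
Qed.

(** Each level adds at most one vertex number to a node: single nodes grow additively, only their
    number is exponential in [k]. *)
Lemma esize_level M k p : p \in level a b chi M k -> esize p <= esize (start_nodes a M) + 2 * k * esize M.
Proof.
elim: k p => [|k IH] p; last first.
  rewrite /level iterS -/(level a b chi M k) => /flattenP[t /mapP[q /IH Hq ->] /esize_branch Hp].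
  by apply: leq_trans Hp (leq_trans (leq_add Hq (leqnn _)) _); rewrite -addnA -mulnDl -mulnSr.
rewrite -[level _ _ _ _ _]/(start_nodes a M) muln0 mul0n addn0.
elim: (start_nodes a M) => //= q r IHr; rewrite inE esize_cons => /predU1P[->|/IHr Hp]; first by rewrite leqW ?leq_addr.
by apply: leq_trans Hp _; rewrite leqW ?leq_addl.
Qed.

Lemma mem_List_In (A : eqType) (x : A) s : List.In x s -> x \in s.
Proof. by elim: s => //= y s IH [->|/IH]; rewrite inE ?eqxx // => ->; rewrite orbT. Qed.

End SearchCost.

Lemma computes_search a b m (chi : fo m) : exists T K d,
  computes (fun p : matrix * nat => search a b chi p.1 p.2) T /\
  forall p, T p <= K ^ p.2.+1 * esize p ^ d.
Proof.
pose s (q : unit * ((matrix * seq node) * unit)) : matrix * seq node :=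
  (q.2.1.1, flatten (map (branch b chi q.2.1.1) q.2.1.2)).
have Ps : ptime s.
  by apply: ptime_pair; [pt | apply/ptime_flatten/ptime_map; [pt | apply: ptime_branch; pt]].
pose pre (p : matrix * nat) := (nseq p.2 tt, ((p.1, start_nodes a p.1), tt)).
have Pstart : ptime (fun p : matrix * nat => start_nodes a p.1) by apply: ptime_start_nodes; pt.
have Ppre : ptime pre by rewrite /pre; pt.
pose post (c : matrix * seq node) := has (fun p => nilp (violations b chi c.1 p)) c.2.
have Ppost : ptime post by apply: ptime_has; [pt | apply/ptime_nilp/ptime_violations; pt].
have [D HD] := computes_foldl Ps; have [F HF pF] := Ppre; have [G HG [g Hg]] := Ppost.
pose (W := fun p : matrix * nat =>
  foldl_esize (fun c u => s (u, (c, tt))) (p.1, start_nodes a p.1) (nseq p.2 tt)).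
pose (T := fun p => F p + (W p + esize (pre p)).+2 ^ D + (W p).+2 ^ g).
(* All quantities are polynomial in [N], and a power of [N] splits into the form
   [K ^ k.+1 * esize p ^ d] that FPT asks for. *)
pose (N := fun p : matrix * nat => b.+2 ^ p.2.+1 * esize p).
have stateE M L i : foldl (fun c u => s (u, (c, tt))) (M, L) (nseq i tt) =
    (M, iter i (fun L => flatten (map (branch b chi M) L)) L).
  by elim: i L => //= i IH L; rewrite IH -iterSr.
have NE p : esize p <= N p by rewrite leq_pmull // expn_gt0.
have pN H : pbound esize H -> pbound N H.
  by move/pbound_trans; apply; apply: pbound_le NE (pbound_self _).
have pW : pbound N W.
  pose (Z := fun p : matrix * nat => esize (start_nodes a p.1)).
  apply: (@pbound_le _ _ _ (fun p : matrix * nat =>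
    esize p + (1 + Z p * N p * (Z p + 2 * esize p * esize p + 1)) + 1)).
    move=> [M k]; apply/bigmax_leqP => /= -[i /= ltik] _.
    have ik : i <= k by rewrite size_nseq in ltik.
    rewrite take_nseq //.
    have Ek : k < esize (M, k) by rewrite esize_pair [esize k]esize_nat; lia.
    have EM : esize M <= esize (M, k) by rewrite esize_pair leqW ?leq_addr.
    rewrite stateE -/(level a b chi M i) esize_pair /= addn1 ltnS leq_add //.
    apply: leq_trans (esize_seq_le (K := Z (M, k) + 2 * esize (M, k) * esize (M, k)) _) _.
      move=> q /mem_List_In /esize_level Hq; apply: leq_trans Hq _.
      by rewrite leq_add2l leq_mul // leq_mul2l /=; apply: leq_trans ik (ltnW Ek).
    rewrite leq_add2l addn1 leq_mul2r; apply/orP; right.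
    apply: leq_trans (size_level _ _ _ _ _) _; apply: leq_mul.
      by apply: ltnW; apply: size_lt_esize.
    apply: (@leq_trans (b.+2 ^ k.+1)); last by rewrite leq_pmulr // esize_gt0.
    apply: (@leq_trans (b.+2 ^ i)); first exact: leq_exp2rW.
    by rewrite leq_exp2l // leqW.
  have pZ : pbound N Z by apply/pN/(ptime_esize Pstart).
  have pE : pbound N esize by apply/pN/pbound_self.
  by pbound_tac.
have pT : pbound N T.
  have pP : pbound N (fun p => esize (pre p)) by apply/pN/ptime_esize.
  have pF' := pN _ pF.
  apply: (@pbound_le _ _ _ (fun p => F p + (W p + esize (pre p) + 2) ^ D + (W p + 2) ^ g)).
    by move=> p; rewrite /T !addn2.
  by pbound_tac.
have [d Hd] := pT; exists T, ((3 * b.+2) ^ d), d; split.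
  have [m0 [c [m0_gt0 Hc]]] := computes_comp (computes_comp HF HD) HG.
  exists m0, c; split=> // st p sp; apply: (reaches_mono (Hc _ _ sp)) => t st' [E le fr].
  split=> //.
    have res : post (foldl (fun c u => s (u, (c, tt))) (p.1, start_nodes a p.1) (nseq p.2 tt)) =
        search a b chi p.1 p.2 by rewrite stateE.
    by rewrite E -res.
  apply: leq_trans le _; rewrite leq_add2l; apply: leq_trans (Hg _) _.
  apply: leq_exp2rW; rewrite !ltnS /=.
  by have := foldl_esizeP (fun c u => s (u, (c, tt))) (p.1, start_nodes a p.1) (nseq p.2 tt) [::]; rewrite cats0.
move=> p; apply: leq_trans (Hd p) _.
have N0 : 0 < N p by apply: leq_trans (NE p); apply: esize_gt0.
apply: (@leq_trans ((3 * N p) ^ d)); first by apply: leq_exp2rW; lia.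
rewrite -expnM [d * _]mulnC expnM -expnMn; apply: leq_exp2rW; rewrite /N mulnA leq_mul2r; apply/orP; right.
by rewrite expnMn leq_mul2r -{1}(expn1 3) leq_exp2l // orbT.
Qed.

(** * Fixed-parameter tractability of vertex removal *)

Definition adjacency (G : sgraph) : matrix :=
  [seq [seq adj u v | v <- enum (vertex G)] | u <- enum (vertex G)].

Lemma adjacency_code G : tree_of_graph G = enc (adjacency G).
Proof. by rewrite /= -map_comp; congr tree_of_seq; apply: eq_map => u /=; rewrite -map_comp. Qed.

Lemma size_adjacency G : size (adjacency G) = #|vertex G|.
Proof. by rewrite size_map cardE. Qed.

Lemma adjacencyE G (u v : vertex G) :
  nth false (nth [::] (adjacency G) (enum_rank u)) (enum_rank v) = adj u v.
Proof.
rewrite (nth_map u) -?cardE ?ltn_ord // (nth_map v) -?cardE ?ltn_ord //.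
by rewrite !nth_enum_rank.
Qed.

Lemma FPT_vertex_removal phi : Sigma 3 phi -> FPT (vertex_removal phi).
Proof.
case/Sigma_block=> a [m [psi [/Pi_block[b [m' [chi [Hchi E2]]]] E1]]].
have mono M V V' e : {subset V <= V'} -> fo_eval M V chi e -> fo_eval M V' chi e.
  exact: Sigma1_mono.
have [T [K [d [HT leT]]]] := computes_search a b chi.
(* Remaining vertices keep their rank in [G], so the matrix of [G] serves for every [delete S]. *)
have deleteP (G : sgraph) (S : {set vertex G}) s : (forall v, (enum_rank v : nat) \in s = (v \in S)) ->
    models (delete S) phi <-> exists x, [/\ size x = a, all_in (alive (adjacency G) s) x &
      forall y, size y = b -> all_in (alive (adjacency G) s) y ->
        fo_eval (adjacency G) (alive (adjacency G) s) chi (y ++ x)].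
  move=> Ss; pose ix (v : vertex (delete S)) : nat := enum_rank (val v).
  rewrite /models (@fo_evalP _ ix (adjacency G) (alive (adjacency G) s)) => [|u v|u v|n].
  - rewrite E1; split=> -[x [sx Vx Hx]]; exists x; split=> //.
      by move/E2: Hx; rewrite cats0.
    by apply/E2; rewrite cats0.
  - by move/val_inj/enum_rank_inj/val_inj.
  - exact: adjacencyE.
  rewrite mem_alive size_adjacency; apply: (iffP andP) => [[lt ns]|[u ->]].
    have nS : enum_val (Ordinal lt) \notin S by rewrite -Ss enum_valK.
    by exists (Sub (enum_val (Ordinal lt)) nS); rewrite /ix SubK enum_valK.
  by rewrite ltn_ord Ss (valP u).
apply: (@FPT_computes (vertex_removal phi) _ _ (fun x : sgraph * nat => (adjacency x.1, x.2)) _ T K d _ HT).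
- by case=> G k; rewrite /= adjacency_code.
- by case=> G k /=; have := leT (adjacency G, k); rewrite adjacency_code.
case=> G k; rewrite [yes _]/= searchP; last exact: mono; split=> /=.
  case=> s [us ls ss Hs]; exists [set v | (enum_rank v : nat) \in s]; split.
    rewrite cardE -(size_map (fun v => enum_rank v : nat)); apply: leq_trans (uniq_leq_size _ _) ss.
      by rewrite map_inj_uniq ?enum_uniq // => u v /val_inj/enum_rank_inj.
    by move=> n /mapP[v]; rewrite mem_enum inE => ? ->.
  by apply: (proj2 (deleteP G _ s _)) Hs => v; rewrite inE.
case=> S [cS HS]; exists [seq (enum_rank v : nat) | v <- enum S].
have injr : injective (fun v : vertex G => enum_rank v : nat) by move=> u v /val_inj/enum_rank_inj.
split; [by rewrite map_inj_uniq ?enum_uniq | | by rewrite size_map -cardE | ].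
  by apply/allP => n /mapP[v _ ->]; rewrite size_adjacency.
by apply: (proj1 (deleteP G S _ _)) HS => v; rewrite (mem_map injr) mem_enum.
Qed.

(** * Certificates for circuits of bounded depth and weft *)

Lemma size_annotate T (step : seq T -> gate -> T) c : size (annotate step c) = size c.
Proof.
elim/last_ind: c => // c g IH; rewrite /annotate -cats1 foldl_cat /= size_rcons.
by rewrite -/(annotate step c) IH size_cat addn1.
Qed.

Lemma nth_annotate T (x : T) step c i : i < size c ->
  nth x (annotate step c) i = step (take i (annotate step c)) (nth GIn c i).
Proof.
elim/last_ind: c => // c g IH; rewrite size_rcons ltnS => le_i.
have -> : annotate step (rcons c g) = rcons (annotate step c) (step (annotate step c) g).
  by rewrite /annotate -cats1 foldl_cat.
have sz := size_annotate step c; rewrite !nth_rcons sz; case: ltngtP le_i => // [lt_i|->] _.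
  by rewrite IH // -cats1 takel_cat // sz ltnW.
by rewrite -cats1 -sz take_size_cat.
Qed.

(** Bounds the depth of gate [i] by [h] and its weft by [w], by recursion from the gate towards the
    inputs. The inductions below descend in this direction, whereas [depth] and [weft] are computed
    upwards. *)
Fixpoint limited (c : circuit) (h w i : nat) : bool :=
  (gate_tag (nth GIn c i) == 0) ||
  (if h is h'.+1 then
     if 2 < size (inputs (nth GIn c i)) then
       (0 < w) && all (limited c h' w.-1) (inputs (nth GIn c i))
     else all (limited c h' w) (inputs (nth GIn c i))
   else false).

(* [certifies c base h i b]: knowing the values given by [base] suffices to see, by looking at the
   gates within distance [h] below gate [i], that gate [i] has value [b]. *)
Fixpoint certifies (c : circuit) (base : nat -> bool -> bool) (h i : nat) (b : bool) : bool :=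
  base i b ||
  (if h is h'.+1 then
     if gate_tag (nth GIn c i) == 0 then false
     else if gate_tag (nth GIn c i) == 1 then
       has (fun j => certifies c base h' j (~~ b)) (inputs (nth GIn c i))
     else if (gate_tag (nth GIn c i) == 2) == b then
       all (fun j => certifies c base h' j b) (inputs (nth GIn c i))
     else has (fun j => certifies c base h' j b) (inputs (nth GIn c i))
   else false).

Definition claim := (nat * bool)%type.
Definition claimed (l : seq claim) (i : nat) (b : bool) : bool := (i, b) \in l.

(* Claims of level [w]: a false claim of level [w + 1] is refuted by few true claims of level [w],
   and the claims of level 0 are literals. *)
Definition of_level (c : circuit) (d w : nat) (p : claim) : bool :=
  limited c d w p.1 &&
  ((gate_tag (nth GIn c p.1) == 0) || (0 < w) && limited c d w.-1 p.1 ||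
   (2 < size (inputs (nth GIn c p.1))) && ((gate_tag (nth GIn c p.1) == 2) == p.2)).

Section Certificates.
Variables (a : pred nat) (c : circuit).
Hypothesis wf : circuit_wf c.

Definition value i := nth false (annotate (gate_value a) c) i.

Lemma gate_wf_nth i : i < size c -> gate_wf i (nth GIn c i).
Proof. by case/andP: wf => _ /allP H lti; apply: H; rewrite mem_iota. Qed.

Lemma inputs_lt i j : i < size c -> j \in inputs (nth GIn c i) -> j < i.
Proof. by move/gate_wf_nth/and3P=> [/allP H _ _]; apply: H. Qed.

Lemma nth_take_annotate T (x : T) step i j : i < size c -> j \in inputs (nth GIn c i) ->
  nth x (take i (annotate step c)) j = nth x (annotate step c) j.
Proof. by move=> lti /(inputs_lt lti) ltj; rewrite nth_take. Qed.

Lemma valueE i : i < size c -> value i =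
  match nth GIn c i with
  | GIn => a i
  | GNot j => ~~ value j
  | GAnd s => all value s
  | GOr s => has value s
  end.
Proof.
move=> lti; rewrite /value nth_annotate //; have := @nth_take_annotate bool false (gate_value a) i ^~ lti.
case E: (nth GIn c i) => [|j|s|s] /= H.
- by rewrite size_take size_annotate lti.
- by rewrite H // inE.
- by apply: eq_in_all => j js; rewrite H.
- by apply: eq_in_has => j js; rewrite H.
Qed.

Lemma leq_bigmax_mem (F : nat -> nat) s j : j \in s -> F j <= \max_(i <- s) F i.
Proof.
elim: s => // i s IH; rewrite inE big_cons => /predU1P[->|/IH]; first exact: leq_maxl.
by move/leq_trans; apply; apply: leq_maxr.
Qed.

Lemma limited_depth_weft h w i : i < size c ->
  nth 0 (annotate (fun vs g =>
    if is_input g then 0 else (\max_(i <- inputs g) nth 0 vs i).+1) c) i <= h ->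
  nth 0 (annotate (fun vs g =>
    (2 < size (inputs g)) + \max_(i <- inputs g) nth 0 vs i) c) i <= w ->
  limited c h w i.
Proof.
set dp := fun vs g => if _ then 0 else _; set wt := fun vs g => _ + _.
have tag0 g : is_input g = (gate_tag g == 0) by case: g.
elim: h w i => [|h IH] w i lti; rewrite !nth_annotate // {1}/dp {1}/wt /limited -/limited tag0;
  case: eqP => //= _.
have takeE T (x : T) step := @nth_take_annotate T x step i ^~ lti.
rewrite ltnS => D W; have Dj j : j \in inputs (nth GIn c i) -> nth 0 (annotate dp c) j <= h.
  move=> js; rewrite -takeE //; apply: leq_trans D.
  exact: (leq_bigmax_mem (nth 0 (take i (annotate dp c)))).
have Wj j : j \in inputs (nth GIn c i) ->
    (2 < size (inputs (nth GIn c i))) + nth 0 (annotate wt c) j <= w.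
  move=> js; rewrite -takeE //; apply: leq_trans W; rewrite leq_add2l.
  exact: (leq_bigmax_mem (nth 0 (take i (annotate wt c)))).
have jlt j : j \in inputs (nth GIn c i) -> j < size c.
  by move=> js; apply: (ltn_trans _ lti); apply: inputs_lt.
case: ifP Wj W => _ Wj W; last by apply/allP => j js; apply: IH; [exact: jlt | exact: Dj | exact: Wj].
rewrite (leq_trans _ W) //=; apply/allP => j js; apply: IH; [exact: jlt | exact: Dj |].
by have := Wj j js; rewrite add1n; case: (w).
Qed.

Lemma circuit_valueE : circuit_value a c = value (size c).-1.
Proof. by rewrite /circuit_value -nth_last size_annotate. Qed.

Lemma certifies_sound (base : nat -> bool -> bool) h i b :
  (forall j b', j < size c -> base j b' -> value j = b') -> i < size c ->
  certifies c base h i b -> value i = b.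
Proof.
move=> Hb; elim: h i b => [|h IH] i b lti /=; first by rewrite orbF; apply: Hb.
case/orP=> [|]; first exact: Hb.
have jlt j : j \in inputs (nth GIn c i) -> j < size c.
  by move=> js; apply: (ltn_trans _ lti); apply: inputs_lt.
rewrite valueE //; case: (nth GIn c i) jlt => [|j|s|s] //= jlt.
- by rewrite orbF => /IH->; rewrite ?negbK // jlt // inE.
- case: eqP => [<-|/eqP nb] H; first by apply/allP => j js; apply: IH; rewrite ?jlt // (allP H).
  have /hasP[j js /IH vj] := H; case: b nb {H} vj => // _ vj.
  by apply/allP => /(_ j js); rewrite vj // jlt.
- case: b => H; last by apply/hasP => -[j js]; rewrite (IH j false) // ?jlt // (allP H).
  by have /hasP[j js /IH vj] := H; apply/hasP; exists j; rewrite // vj // jlt.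
Qed.

Lemma certifies_mono (base base' : nat -> bool -> bool) h i b : (forall j b', base j b' -> base' j b') ->
  certifies c base h i b -> certifies c base' h i b.
Proof.
move=> Hb; elim: h i b => [|h IH] i b /=; first by rewrite !orbF; apply: Hb.
case/orP=> [/Hb->//|H]; apply/orP; right; move: H.
case: ifP => // _; case: ifP => _; last case: ifP => _.
- by case/hasP=> j js /IH Hj; apply/hasP; exists j.
- by move/allP=> H; apply/allP => j /H/IH.
- by case/hasP=> j js /IH Hj; apply/hasP; exists j.
Qed.

Lemma certifies_inputs base h i : i < size c -> gate_tag (nth GIn c i) != 0 ->
  (forall j, j \in inputs (nth GIn c i) -> certifies c base h j (value j)) ->
  certifies c base h.+1 i (value i).
Proof.
move=> lti tag H; rewrite /= (negbTE tag); apply/orP; right; move: H tag.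
rewrite [value i]valueE //; case: (nth GIn c i) => [|j|s|s] //= H _.
- by rewrite negbK H ?inE.
- case: (boolP (all value s)) => /= [/allP Hs|/allPn[j js nj]].
    by apply/allP => j js; rewrite -(Hs j js); apply: H.
  by apply/hasP; exists j => //; rewrite -(negbTE nj); apply: H.
- case: (boolP (has value s)) => /= [/hasP[j js vj]|/hasPn Hs].
    by apply/hasP; exists j => //; rewrite -vj; apply: H.
  by apply/allP => j js; rewrite -(negbTE (Hs j js)); apply: H.
Qed.

(* A true disjunction or a false conjunction owes its value to a single input. *)
Lemma certifies_witness i : i < size c -> 1 < gate_tag (nth GIn c i) ->
  (gate_tag (nth GIn c i) == 2) != value i ->
  exists2 j, j \in inputs (nth GIn c i) & forall base h,
    certifies c base h j (value j) -> certifies c base h.+1 i (value i).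
Proof.
move=> lti tag2 dual; have [j js vj] : exists2 j, j \in inputs (nth GIn c i) & value j = value i.
  move: dual; rewrite [value i]valueE //; case: (nth GIn c i) tag2 => [|j|s|s] //= _.
    by case: (boolP (all value s)) => //= /allPn[j js /negbTE nj] _; exists j.
  by case: (boolP (has value s)) => //= /hasP[j js vj] _; exists j.
exists j => // base h H; apply/orP; right; move: tag2 dual; case: (gate_tag _) => [|[|t]] // _ dual.
by rewrite (negbTE dual); apply/hasP; exists j; rewrite // -vj.
Qed.

Lemma limited_mono h h' w w' i : h <= h' -> w <= w' -> limited c h w i -> limited c h' w' i.
Proof.
elim: h h' w w' i => [|h IH] h' w w' i; first by case: h' => [|h'] _ _ /=; rewrite orbF => ->.
case: h' => // h' leh lew; rewrite /limited -/limited; case/orP=> [->//|].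
case: ifP => [_ /andP[w0 /allP H]|_ /allP H]; apply/orP; right.
  rewrite (leq_trans w0 lew); apply/allP => j /H; apply: IH => //.
  by rewrite -!subn1 leq_sub2r.
by apply/allP => j /H; apply: IH.
Qed.

Definition true_of_level d w (l : seq claim) :=
  all (fun p => [&& of_level c d w p, value p.1 == p.2 & p.1 < size c]) l.

Lemma claimed_cat l l' j b : claimed l j b || claimed l' j b -> claimed (l ++ l') j b.
Proof. by rewrite /claimed mem_cat. Qed.

(** Sizes add up only at gates with at most two inputs. A large gate contributes a single claim,
    about itself or about one input of smaller weft, whatever lies below it. *)
Lemma certificate d h w i : h <= d -> i < size c -> limited c h w i ->
  exists l, [/\ size l <= 2 ^ h, true_of_level d w l & certifies c (claimed l) h i (value i)].
Proof.
have cert1 h' j b : certifies c (claimed [:: (j, b)]) h' j b.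
  by case: h' => /=; rewrite /claimed inE eqxx.
elim: h w i => [|h IH] w i leh lti lim.
  exists [:: (i, value i)]; split=> //; rewrite /true_of_level /= lti eqxx !andbT /of_level /=.
  by rewrite (limited_mono leh (leqnn w) lim); move: lim; rewrite /= orbF => ->.
have jlt j : j \in inputs (nth GIn c i) -> j < size c.
  by move=> js; apply: (ltn_trans _ lti); apply: inputs_lt.
have [tag0|tag] := boolP (gate_tag (nth GIn c i) == 0).
  exists [:: (i, value i)]; split=> //; first by rewrite expn_gt0.
  by rewrite /true_of_level /= lti eqxx !andbT /of_level /= tag0 (limited_mono leh (leqnn w) lim).
move: (lim); rewrite /limited -/limited (negbTE tag) orFb; case: ifP => [large /andP[w0 /allP lims]|small /allP lims].
  have [univ|dual] := boolP ((gate_tag (nth GIn c i) == 2) == value i).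
    exists [:: (i, value i)]; split=> //; first by rewrite expn_gt0.
    rewrite /true_of_level /= lti eqxx !andbT /of_level /= univ large.
    by rewrite (limited_mono leh (leqnn w) lim) !orbT.
  have tag2 : 1 < gate_tag (nth GIn c i) by case: (nth GIn c i) large.
  have [j js Hj] := certifies_witness lti tag2 dual.
  exists [:: (j, value j)]; split; first by rewrite expn_gt0.
    rewrite /true_of_level /= jlt // eqxx !andbT /of_level /= w0 !(limited_mono _ _ (lims j js)) ?orbT //.
    1-3: by rewrite ?leq_pred ?(ltnW leh).
  exact: Hj.
have [l [sl tl cl]] : exists l, [/\ size l <= size (inputs (nth GIn c i)) * 2 ^ h, true_of_level d w l &
    forall j, j \in inputs (nth GIn c i) -> certifies c (claimed l) h j (value j)].
  elim: (inputs (nth GIn c i)) lims jlt => [|j s IHs] lims jlt; first by exists [::].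
  have [l1 [s1 t1 c1]] := IH w j (ltnW leh) (jlt j (mem_head j s)) (lims j (mem_head j s)).
  have [j' js|j' js|l2 [s2 t2 c2]] := IHs; [by apply: lims; rewrite inE js orbT | by apply: jlt; rewrite inE js orbT |].
  exists (l1 ++ l2); split; first by rewrite size_cat mulSn leq_add.
    by rewrite /true_of_level all_cat; apply/andP.
  move=> j'; rewrite inE => /predU1P[->|/c2 c2'].
    by apply: certifies_mono c1 => k b H; apply: claimed_cat; rewrite H.
  by apply: certifies_mono c2' => k b H; apply: claimed_cat; rewrite H orbT.
exists l; split=> //; last exact: certifies_inputs.
by apply: leq_trans sl _; rewrite expnS leq_mul2r leqNgt small orbT.
Qed.

(** A claim of level [w.+1] about a large gate may assert something of all its inputs; if false, it
    is disproved by one input, whose weft is at most [w]. The other claims of this level concern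
    input gates or gates of weft at most [w], which have certificates of level [w] directly. *)
Lemma refutation d w i b : i < size c -> of_level c d w.+1 (i, b) -> value i != b ->
  exists l, [/\ size l <= 2 ^ d, true_of_level d w l & certifies c (claimed l) d i (~~ b)].
Proof.
move=> lti lev nb; have -> : ~~ b = value i by case: b (value i) nb {lev} => [] [].
have [tag0|tag] := boolP (gate_tag (nth GIn c i) == 0).
  by apply: certificate => //; case: (d) => [|d'] /=; rewrite tag0.
case/andP: lev => /= lim; rewrite (negbTE tag) /= => /orP[lim'|/andP[large univ]].
  exact: certificate.
have tag2 : 1 < gate_tag (nth GIn c i) by case: (nth GIn c i) large.
have [|j js Hj] := certifies_witness lti tag2; first by rewrite (eqP univ) eq_sym.
case: d lim => [|d]; rewrite /limited -/limited (negbTE tag) //= large => /allP/(_ j js) limj.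
have ltj : j < size c by apply: (ltn_trans _ lti); apply: inputs_lt.
have [l [sl tl cl]] := certificate (leqnSn d) ltj limj; exists l; split=> //; last exact: Hj.
by apply: leq_trans sl _; rewrite leq_exp2l.
Qed.

(** A large gate has weft at least 1, so only input gates remain at level 0. *)
Lemma of_level0 d p : of_level c d 0 p -> gate_tag (nth GIn c p.1) == 0.
Proof.
case/andP; case: d => [|d]; rewrite /limited -/limited /= ?orbF //.
by case/orP=> // + /orP[]//; case: ifP => // _ _ /orP[].
Qed.
End Certificates.

Ltac pt_extra ::= match goal with
  | |- ptime (fun x => gate_tag (@?f x)) => apply: ptime_gate_tag
  | |- ptime (fun x => inputs (@?f x)) => apply: ptime_inputs
  end.

Lemma ptime_limited h X (EX : encodable X) (c : X -> seq gate) (w i : X -> nat) :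
  ptime c -> ptime w -> ptime i -> ptime (fun x => limited (c x) h (w x) (i x)).
Proof.
elim: h X EX c w i => [|h IH] X EX c w i Pc Pw Pi /=; first by pt.
apply: ptime_orb; first by pt.
apply: ptime_if; first by pt.
  by apply: ptime_andb; [pt | apply: ptime_all; [pt | apply: IH; pt]].
by apply: ptime_all; [pt | apply: IH; pt].
Qed.

Lemma ptime_of_level d w X (EX : encodable X) (c : X -> seq gate) (p : X -> claim) :
  ptime c -> ptime p -> ptime (fun x => of_level (c x) d w (p x)).
Proof.
by move=> Pc Pp; rewrite /of_level; repeat first [apply: ptime_limited | pt_step].
Qed.

(** A predicate has no code, so [base] is a family of predicates indexed by encodable data. *)
Lemma ptime_certifies h X Y (EX : encodable X) (EY : encodable Y)
    (base : Y -> nat -> bool -> bool) (y : X -> Y) (c : X -> seq gate) (i : X -> nat) (b : X -> bool) :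
  ptime (fun p : (nat * bool) * Y => base p.2 p.1.1 p.1.2) -> ptime y -> ptime c -> ptime i -> ptime b ->
  ptime (fun x => certifies (c x) (base (y x)) h (i x) (b x)).
Proof.
move=> Pbase; elim: h X EX y c i b => [|h IH] X EX y c i b Py Pc Pi Pb /=.
all: have P0 : ptime (fun x => base (y x) (i x) (b x)) by
  apply: (@ptime_comp _ _ _ _ _ _ (fun x => ((i x, b x), y x)) _ Pbase); pt.
  by pt.
by repeat first [apply: IH | pt_step].
Qed.

(** * From weighted circuits to covering problems *)

(* A [k]-element set of input gates is presented as a chain of positions: the input gate [i] has
   position [i + 1], and [u 1 < ... < u k] are the positions of the chosen gates.  A consecutive
   pair [u j, u j.+1] shows positively that the gates between the two are not chosen. *)
Definition is_chain (c : circuit) k (u : nat -> nat) : Prop :=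
  [/\ u 0 = 0, u k.+1 = (size c).+1, forall j, j <= k -> u j < u j.+1
    & forall j, 0 < j <= k -> gate_tag (nth GIn c (u j).-1) == 0].

Definition chosen (u : nat -> nat) k : pred nat := fun i => has (fun j => u j == i.+1) (iota 1 k).

Lemma tag_is_input g : is_input g = (gate_tag g == 0).
Proof. by case: g. Qed.

(** * Chains and assignments of weight [k] *)

Section Chains.
Variables (c : circuit) (k : nat).

Lemma chain_lt u i j : is_chain c k u -> i < j -> j <= k.+1 -> u i < u j.
Proof.
case=> _ _ inc _; elim: j => // j IH; rewrite ltnS leq_eqVlt => /predU1P[->|lt]; rewrite ltnS => lej.
  exact: inc.
by apply: ltn_trans (inc j lej); apply: IH => //; apply: leqW.
Qed.

Lemma chain_leq u i j : is_chain c k u -> i <= j -> j <= k.+1 -> u i <= u j.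
Proof.
by move=> ch; rewrite leq_eqVlt => /predU1P[->//|lt] lej; apply/ltnW/(chain_lt ch lt lej).
Qed.

Lemma chain_gap u x m : is_chain c k u -> x < u m -> exists2 j, j < m & u j <= x < u j.+1.
Proof.
case=> u0 _ _ _; elim: m => [|m IH]; first by rewrite u0.
move=> lt; case: (leqP (u m) x) => [le|/IH[j ltj Hj]]; first by exists m; rewrite ?le.
by exists j => //; apply: leqW.
Qed.

Lemma chain_inj u i j : is_chain c k u -> i <= k.+1 -> j <= k.+1 -> u i = u j -> i = j.
Proof.
move=> ch li lj E; case: (ltngtP i j) => // lt.
  by have := chain_lt ch lt lj; rewrite E ltnn.
by have := chain_lt ch lt li; rewrite E ltnn.
Qed.

Lemma weight_of_chain u : is_chain c k u -> weight (chosen u k) c = k.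
Proof.
move=> ch; have [u0 uk inc inp] := ch; rewrite /weight -size_filter.
rewrite -[RHS](size_iota 1 k) -[RHS](size_map (fun j => (u j).-1)); apply/perm_size/uniq_perm.
- by apply/filter_uniq/iota_uniq.
- rewrite map_inj_in_uniq ?iota_uniq // => i j; rewrite !mem_iota add1n !ltnS => /andP[i0 ik] /andP[j0 jk] E.
  have ui := chain_lt ch i0 (leqW ik); have uj := chain_lt ch j0 (leqW jk).
  by apply: (chain_inj ch); rewrite ?leqW //; rewrite u0 in ui uj; lia.
move=> i; rewrite mem_filter mem_iota add0n; apply/andP/mapP.
  case=> /andP[_ /hasP[j jk /eqP uj]] _; exists j => //; by rewrite uj.
case=> j jk ->; move: (jk); rewrite mem_iota add1n ltnS => /andP[j0 lejk].
have uj := chain_lt ch j0 (leqW lejk); rewrite u0 in uj.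
have := chain_lt ch (lejk : j < k.+1) (leqnn _); rewrite uk => uj'.
rewrite tag_is_input inp ?j0 //; split; last by lia.
by apply/hasP; exists j; rewrite // prednK.
Qed.

Lemma chain_of_weight a : weight a c = k -> exists2 u, is_chain c k u &
  forall i, i < size c -> gate_tag (nth GIn c i) == 0 -> a i = chosen u k i.
Proof.
pose s := [seq i <- iota 0 (size c) | is_input (nth GIn c i) && a i].
(* Positions are shifted by one, which leaves 0 free as a sentinel before the first chosen input;
   [(size c).+1] is the sentinel after the last. *)
rewrite /weight -size_filter -/s => sk; pose t := 0 :: rcons (map S s) (size c).+1.
have lts i : i \in s -> i < size c by rewrite mem_filter mem_iota => /andP[].
have uS j : j < k -> nth 0 t j.+1 = (nth 0 s j).+1.
  by move=> ltj; rewrite /= nth_rcons size_map sk ltj (nth_map 0) ?sk.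
have srt : sorted ltn t.
  rewrite /= rcons_path; apply/andP; split.
    rewrite path_sortedE; last exact: ltn_trans.
    apply/andP; split; first by apply/allP => ? /mapP[? _ ->].
    by rewrite sorted_map; apply: sorted_filter; [exact: ltn_trans | exact: iota_ltn_sorted].
  have := mem_last 0 (map S s); rewrite inE => /predU1P[->//|/mapP[i si ->]].
  exact: lts.
exists (nth 0 t); first split=> //.
- by rewrite /= nth_rcons size_map sk ltnn eqxx.
- move=> j lej; apply: (sorted_ltn_nth ltn_trans 0 srt) => //; rewrite inE /= size_rcons size_map sk //.
  by rewrite ltnS leqW.
- case=> // j /= ltj; rewrite -[nth 0 _ j]/(nth 0 t j.+1) uS //=.
  have : nth 0 s j \in s by rewrite mem_nth ?sk.
  by rewrite mem_filter tag_is_input => /andP[/andP[]].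
move=> i lti inp; apply/idP/hasP => [ai|[[|j]]].
  have si : i \in s by rewrite mem_filter mem_iota tag_is_input inp ai.
  have lt : index i s < k by rewrite -sk index_mem.
  by exists (index i s).+1; rewrite ?uS ?nth_index // mem_iota add1n ltnS.
  by rewrite mem_iota.
rewrite mem_iota add1n ltnS => /andP[_ ltj]; rewrite uS // => /eqP[<-].
have : nth 0 s j \in s by rewrite mem_nth ?sk.
by rewrite mem_filter => /andP[/andP[]].
Qed.
End Chains.

(* [((j, (u, v)), [::])] says that the [j]-th step of the chain leads from [u] to [v]; the items
   [((k + 1, (0, 0)), l)] select a certificate [l] for the output gate. *)
Definition item := ((nat * (nat * nat)) * seq claim)%type.

(** Further items only add literals and never withdraw one. A certificate item carries the pair
    [(0, 0)] and thus covers nothing. *)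
Definition covered (c : circuit) (P : seq item) (i : nat) (b : bool) : bool :=
  (gate_tag (nth GIn c i) == 0) &&
  has (fun x : item => if b then x.1.2.1 == i.+1 else (x.1.2.1 < i.+1) && (i.+1 < x.1.2.2)) P.

Definition claims (c : circuit) : seq claim :=
  [seq (i, b) | i <- iota 0 (size c), b <- [:: true; false]].

Definition certificates (c : circuit) d : seq (seq claim) :=
  [seq l <- lists (2 ^ d) [seq p <- claims c | of_level c d 2 p] |
     certifies c (claimed l) d (size c).-1 true].

Definition objections (c : circuit) d : seq (seq claim) :=
  lists (2 ^ d) [seq p <- claims c | of_level c d 1 p].

(** Only what a single step can show by itself; that consecutive steps fit together is left to the
    clauses. The two equivalences reserve the sentinels for the first and the last step. *)
Definition step_ok (c : circuit) k (x : item) : bool :=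
  (x.1.2.1 < x.1.2.2) && (((x.1.1 == 0) == (x.1.2.1 == 0)) &&
  (((x.1.1 == k) == (x.1.2.2 == (size c).+1)) &&
  ((x.1.2.1 == 0) || (gate_tag (nth GIn c x.1.2.1.-1) == 0)))).

Definition steps (c : circuit) k : seq item :=
  [seq x <- [seq ((j, uv), [::]) | j <- iota 0 k.+1,
               uv <- [seq (u, v) | u <- iota 0 (size c).+2, v <- iota 0 (size c).+2]]
     | step_ok c k x].

Definition items (c : circuit) k d : seq item :=
  steps c k ++ [seq ((k.+1, (0, 0)), l) | l <- certificates c d].

Definition clause := ((nat * nat) * (seq claim * seq claim))%type.

(** Kind 0 asks for an item of each group, kind 1 for consecutive steps that meet, kind 2 for a
    reply to an objection that would refute a claim of the certificate. *)
Definition clauses (c : circuit) k d : seq clause :=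
  [seq ((0, j), ([::], [::])) | j <- iota 0 k.+2] ++
  [seq ((1, j), ([::], [::])) | j <- iota 0 k] ++
  [seq ((2, 0), lm) | lm <- [seq lm <- [seq (l, m) | l <- certificates c d, m <- objections c d] |
     has (fun p => certifies c (claimed lm.2) d p.1 (~~ p.2)) lm.1]].

(** That a certificate is not the selected one is expressed positively, by an item with a different
    certificate. This is sound because the clauses of kind 0 and the budget leave one item per
    group. *)
Definition satisfies (c : circuit) k d (cl : clause) (P : seq item) : bool :=
  if cl.1.1 == 0 then has (fun x : item => x.1.1 == cl.1.2) P
  else if cl.1.1 == 1 then
    has (fun x : item => has (fun y : item =>
      (x.1.1 == cl.1.2) && ((y.1.1 == cl.1.2.+1) && (x.1.2.2 == y.1.2.1))) P) P
  else has (fun x : item => (x.1.1 == k.+1) && (x.2 != cl.2.1)) P ||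
    has (fun p => certifies c (covered c P) d p.1 (~~ p.2)) cl.2.2.

(** The length [(2 ^ d).+1] of terms allows for the [2 ^ d] literals of a reply, and for the two
    items of a clause of kind 1 even if [d] is 0. *)
Definition covering (c : circuit) k d (D : seq item) : Prop :=
  [/\ {subset D <= items c k d}, size D <= k.+2 & forall cl, cl \in clauses c k d ->
      exists P, [/\ P \in lists (2 ^ d).+1 (items c k d), {subset P <= D} & satisfies c k d cl P]].

Lemma mem_claims c p : (p \in claims c) = (p.1 < size c).
Proof.
case: p => i b /=; apply/allpairsP/idP => [[[j b'] /= [+ _ [-> _]]]|lti]; first by rewrite mem_iota.
by exists (i, b); rewrite mem_iota lti; case: b.
Qed.

Lemma true_level_sub a c d w l : true_of_level a c d w l ->
  all (mem [seq p <- claims c | of_level c d w p]) l.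
Proof. by apply: sub_all => p /and3P[lev _ lt]; rewrite /= mem_filter lev mem_claims. Qed.

Lemma mem_steps c k x : (x \in steps c k) =
  [&& step_ok c k x, x.1.1 <= k, x.1.2.1 < (size c).+2, x.1.2.2 < (size c).+2 & x.2 == [::]].
Proof.
have hI j : (j \in iota 0 k.+1) = (j <= k) by rewrite mem_iota ltnS.
have hJ j : (j \in iota 0 (size c).+2) = (j < (size c).+2) by rewrite mem_iota.
rewrite mem_filter; case: (step_ok c k x) => //.
move: (iota 0 k.+1) (iota 0 (size c).+2) hI hJ => I J hI hJ.
case: x => [[j [u v]] l] /=; apply/allpairsP/and4P => [[[j' uv] /= [jk /allpairsP[[u' v'] /= [hu hv ->]]]]|].
  by case=> -> -> -> ->; rewrite -hI -!hJ.
case=> jk hu hv /eqP->; exists (j, (u, v)); rewrite /= hI; split=> //.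
by apply/allpairsP; exists (u, v); rewrite !hJ.
Qed.

(** * Equivalence of circuit satisfiability and covering *)

Section CoveringCorrect.
Variables (c : circuit) (k d : nat).
Hypotheses (wf : circuit_wf c) (Hd : depth c <= d) (Hw : weft c <= 2).

Let out := (size c).-1.

Lemma out_lt : out < size c.
Proof. by case/andP: wf => c0 _; rewrite /out; case: (size c) c0. Qed.

Lemma limited_out : limited c d 2 out.
Proof.
apply: limited_depth_weft => //; first exact: out_lt.
  by move: Hd; rewrite /depth -nth_last size_annotate.
by move: Hw; rewrite /weft -nth_last size_annotate.
Qed.

Lemma value_input a i : i < size c -> gate_tag (nth GIn c i) == 0 -> value a c i = a i.
Proof. by move=> lti; rewrite valueE //; case: (nth GIn c i). Qed.

Definition chain_items (u : nat -> nat) : seq item :=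
  [seq ((j, (u j, u j.+1)), [::]) | j <- iota 0 k.+1].

Lemma chain_items_steps u : is_chain c k u -> {subset chain_items u <= steps c k}.
Proof.
move=> ch; have [u0 uk inc inp] := ch => _ /mapP[j + ->]; rewrite mem_iota add0n ltnS => /= lej.
rewrite mem_steps; apply/and5P; split=> //=.
- rewrite /step_ok /= inc //=; apply/and3P; split.
  + apply/eqP; case: (posnP j) => [->|j0]; first by rewrite u0.
    by have := chain_lt ch j0 (leqW lej); rewrite u0; case: (u j) j0 => //; case: (j).
  + apply/eqP; case: (eqVneq j k) => [->|nj]; first by rewrite uk eqxx.
    have lt : j.+1 < k.+1 by rewrite ltnS ltn_neqAle nj.
    by have := chain_lt ch lt (leqnn _); rewrite uk; case: eqP => // ->; rewrite ltnn.
  + by case: (posnP j) => [->|j0]; rewrite ?u0 // inp ?j0 ?orbT.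
- have lt : j < k.+1 by rewrite ltnS.
  by have := chain_lt ch lt (leqnn _); rewrite uk => /ltnW.
- move: lej; rewrite leq_eqVlt => /predU1P[->|lt]; first by rewrite uk.
  have lt' : j.+1 < k.+1 by [].
  by have := chain_lt ch lt' (leqnn _); rewrite uk => /ltnW.
Qed.

(** Position [i.+1] lies in exactly one half-open gap of the chain, and the gate is chosen iff it is
    the left end of this gap; so one step shows either literal. *)
Lemma chain_covers u i b : is_chain c k u -> i < size c -> gate_tag (nth GIn c i) == 0 ->
  chosen u k i = b -> exists2 x, x \in chain_items u & covered c [:: x] i b.
Proof.
move=> ch lti inp <-; have [u0 uk _ _] := ch.
have [j ltj /andP[le lt]] : exists2 j, j < k.+1 & u j <= i.+1 < u j.+1.
  by apply: (chain_gap ch); rewrite uk.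
exists ((j, (u j, u j.+1)), [::]); first by apply/mapP; exists j; rewrite // mem_iota.
rewrite /covered inp /= orbF; case: ifP => [/hasP[l]|nch].
  rewrite mem_iota add1n ltnS => /andP[l0 lel] /eqP ul; rewrite eqn_leq le -ul /=.
  case: (leqP l j) => [lej|ltj']; first by rewrite (chain_leq ch lej) // ltnW.
  by move: lt; rewrite -ul ltnNge (chain_leq ch ltj') // leqW.
rewrite lt andbT ltn_neqAle le andbT; apply/negP => uj; case/negP: nch; apply/hasP; exists j => //.
rewrite mem_iota add1n ltj andbT lt0n; apply: contraTneq uj => ->; by rewrite u0.
Qed.

Lemma covering_of_weight a : weight a c = k -> circuit_value a c -> exists D, covering c k d D.
Proof.
move=> /chain_of_weight[u ch ua]; rewrite circuit_valueE -/out => vout.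
have [l [sl tl cl]] := certificate a wf (leqnn d) out_lt limited_out.
rewrite vout in cl.
have l_cert : l \in certificates c d by rewrite mem_filter cl mem_lists sl (true_level_sub tl).
pose top : item := ((k.+1, (0, 0)), l); pose D := rcons (chain_items u) top.
have DI : {subset D <= items c k d}.
  move=> x; rewrite mem_rcons inE mem_cat => /predU1P[->|/(chain_items_steps ch)->] //.
  by rewrite map_f ?orbT.
have topD : top \in D by rewrite mem_rcons mem_head.
have chD j : j <= k -> ((j, (u j, u j.+1)), [::]) \in D.
  by move=> lej; rewrite mem_rcons inE; apply/orP; right; apply/mapP; exists j; rewrite // mem_iota.
have witness cl' P : size P <= (2 ^ d).+1 -> {subset P <= D} -> satisfies c k d cl' P ->
    exists P, [/\ P \in lists (2 ^ d).+1 (items c k d), {subset P <= D} & satisfies c k d cl' P].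
  move=> sP PD HP; exists P; split=> //; rewrite mem_lists sP; apply/allP => x /PD/DI //.
have e0 : 0 < 2 ^ d by rewrite expn_gt0.
exists D; split=> //; first by rewrite size_rcons size_map size_iota.
move=> cl'; rewrite !mem_cat => /or3P[] /mapP.
- case=> j; rewrite mem_iota add0n ltnS /= leq_eqVlt => /predU1P[->|lej] ->.
    by apply: (witness _ [:: top]) => // [x|]; rewrite ?inE ?/satisfies /= ?eqxx // => /eqP->.
  apply: (witness _ [:: ((j, (u j, u j.+1)), [::])]) => // [x|].
    by rewrite inE => /eqP->; apply: chD.
  by rewrite /satisfies /= eqxx.
- case=> j; rewrite mem_iota => /= ltj ->.
  apply: (witness _ [:: ((j, (u j, u j.+1)), [::]); ((j.+1, (u j.+1, u j.+2)), [::])]) => // [x|].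
    by rewrite !inE => /orP[] /eqP->; [apply: (chD j (ltnW ltj)) | apply: (chD j.+1 ltj)].
  by rewrite /satisfies /= !eqxx /= orbT.
case=> -[l' m]; rewrite mem_filter => /andP[/hasP[p pl' cm] /allpairsP[[l1 m1] [/= _ Hm [E1 E2]]]] ->.
subst l1 m1; have [El|nl] := eqVneq l l'; last first.
  apply: (witness _ [:: top]) => // [x|]; first by rewrite inE => /eqP->.
  by rewrite /satisfies /= eqxx nl.
subst l'; have [_ /eqP vp ltp] := and3P (allP tl p pl').
(* If all claims of the objection were true, they would by soundness refute the true claim [p]. *)
have [p' pm np'] : exists2 p', p' \in m & value a c p'.1 != p'.2.
  apply/hasP; apply: contraT => /hasPn Hall.
  suff : value a c p.1 = ~~ p.2 by rewrite vp; case: (p.2).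
  apply: certifies_sound ltp cm => // j b' _ /Hall; by rewrite negbK => /eqP.
move: Hm; rewrite mem_lists => /andP[sm /allP/(_ _ pm)]; rewrite /= mem_filter mem_claims => /andP[lev ltp'].
have [|l0 [sl0 tl0 cl0]] := @refutation a c wf d 0 p'.1 p'.2 ltp' _ np'; first by case: (p') lev.
(* One chain item for each literal keeps the term within the permitted length. *)
have [P [sP PD HP]] : exists P, [/\ size P <= size l0, {subset P <= D} &
    forall q, q \in l0 -> covered c P q.1 q.2].
  elim: l0 {sl0 cl0} tl0 => [|q l0 IH] tl0; first by exists [::].
  case/andP: tl0 => /and3P[/of_level0 inq /eqP vq ltq] /IH[P [sP PD HP]].
  have [|x xc xq] := @chain_covers u q.1 q.2 ch ltq inq; first by rewrite -ua // -value_input.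
  exists (x :: P); split=> // [y|y].
    by rewrite inE => /predU1P[->|/PD//]; rewrite mem_rcons inE xc orbT.
  rewrite inE => /predU1P[->|/HP].
    by move: xq; rewrite /covered => /andP[-> /=]; rewrite orbF => ->.
  by rewrite /covered => /andP[-> /=] ->; rewrite orbT.
apply: (witness _ P) => //; first by rewrite (leq_trans sP) // leqW.
rewrite /satisfies /=; apply/orP; right; apply/hasP; exists p' => //.
by apply: certifies_mono cl0 => j b; apply: (HP (j, b)).
Qed.

Lemma weight_of_covering D : covering c k d D -> exists2 a, weight a c = k & circuit_value a c.
Proof.
case=> DI sD HD.
have group j : j < k.+2 -> exists2 x, x \in D & x.1.1 == j.
  move=> ltj; have [|P [_ PD /hasP[x /PD xD xj]]] := HD ((0, j), ([::], [::])); last by exists x.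
  by rewrite mem_cat map_f // mem_iota.
(* All [k.+2] groups are hit by at most [k.+2] items, so no group is hit twice. *)
have uD : uniq (map (fun x : item => x.1.1) D).
  apply: (leq_size_uniq (iota_uniq 0 k.+2)); last by rewrite size_map size_iota.
  by move=> j; rewrite mem_iota => /= /group[x xD /eqP<-]; apply: map_f.
have inj x y : x \in D -> y \in D -> x.1.1 = y.1.1 -> x = y.
  move=> xD yD E; rewrite -(nth_index x xD) -(nth_index x yD); congr nth.
  apply/eqP; rewrite -(nth_uniq 0 _ _ uD) ?size_map ?index_mem //.
  by rewrite !(nth_map x) ?index_mem // !nth_index // E.
pose X j : item := nth ((0, (0, 0)), [::]) D (find (fun x : item => x.1.1 == j) D).
have XP j : j < k.+2 -> X j \in D /\ (X j).1.1 = j.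
  case/group=> x xD xj; have hD : has (fun x : item => x.1.1 == j) D by apply/hasP; exists x.
  by split; [rewrite mem_nth -?has_find | apply/eqP/(@nth_find _ _ (fun x : item => x.1.1 == j))].
have stepX j : j <= k -> X j \in steps c k.
  move=> lej; have [/DI + E] := XP j (leqW lej); rewrite mem_cat => /orP[//|/mapP[l _ El]].
  by move: lej; rewrite -E El ltnn.
have [topD topE] := XP k.+1 (leqnn _).
have [l lC El] : exists2 l, l \in certificates c d & X k.+1 = ((k.+1, (0, 0)), l).
  move/DI: topD; rewrite mem_cat => /orP[|/mapP[l]]; last by exists l.
  by rewrite mem_steps topE => /and5P[_]; rewrite ltnn.
pose u j := if j <= k then (X j).1.2.1 else (size c).+1.
have uX j : j <= k -> (X j).1.2.2 = u j.+1.
  move=> lej; rewrite /u; case: (ltnP j k) => [ltj|lekj].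
    have [|P [_ PD]] := HD ((1, j), ([::], [::])).
      by rewrite !mem_cat [X in _ || (X || _)]map_f ?orbT // mem_iota.
    rewrite /satisfies /= => /hasP[x /PD xD /hasP[y /PD yD /and3P[/eqP xj /eqP yj /eqP E]]].
    have [[XD XE] [XD' XE']] := (XP j (leqW lej), XP j.+1 (leqW ltj)).
    have -> : X j = x by apply: inj => //; rewrite XE xj.
    have -> : X j.+1 = y by apply: inj => //; rewrite XE' yj.
    exact: E.
  have/eqP Ejk : j == k by rewrite eqn_leq lej.
  have := stepX j lej; rewrite mem_steps => /and5P[/and4P[_ _ + _] _ _ _ _].
  by have [_ ->] := XP j (leqW lej); rewrite Ejk eqxx => /eqP/esym/eqP.
have ch : is_chain c k u.
  have ok j : j <= k -> step_ok c k (X j) by move/stepX; rewrite mem_steps => /and5P[].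
  split.
  - rewrite /u leq0n; have /and4P[_ + _ _] := ok 0 isT.
    by have [_ ->] := XP 0 isT; rewrite eqxx => /eqP/esym/eqP.
  - by rewrite /u ltnn.
  - by move=> j lej; have /and4P[+ _ _ _] := ok j lej; rewrite uX // {2}/u lej.
  - move=> j /andP[j0 lej]; have /and4P[_ + _] := ok j lej; rewrite /u lej.
    have [_ ->] := XP j (leqW lej); case: j j0 {lej} => // j _ /eqP/esym/negbT/negbTE E.
    by rewrite E.
pose a := chosen u k; exists a; first exact: weight_of_chain.
have DX x : x \in D -> x.1.1 <= k -> x.1.2.1 = u x.1.1 /\ x.1.2.2 = u x.1.1.+1.
  move=> xD lex; have [XD XE] := XP x.1.1 (leqW lex).
  by rewrite -uX // /u lex -(inj _ _ xD XD).
(* Every selected step is a step of the chain [u], so the literals that it shows are true under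
   [a]. *)
have cov P i b : {subset P <= D} -> i < size c -> covered c P i b -> value a c i = b.
  move=> PD lti /andP[inp /hasP[x /PD xD]]; rewrite value_input //.
  case: (leqP x.1.1 k) => [lex|gtx]; last first.
    suff -> : x = X k.+1 by rewrite El /=; case: b.
    apply: inj => //; rewrite topE; apply/eqP; rewrite eqn_leq gtx andbT.
    move/DI: xD; rewrite mem_cat => /orP[|/mapP[l' _ ->]] //.
    by rewrite mem_steps => /and5P[_ lex _ _ _]; rewrite ltnNge lex in gtx.
  have [-> ->] := DX x xD lex; have [u0 uk _ _] := ch.
  case: b => [/eqP ux|/andP[lt1 lt2]].
    apply/hasP; exists x.1.1; last by rewrite ux.
    by rewrite mem_iota add1n ltnS lex andbT lt0n; apply/eqP => E; rewrite E u0 in ux.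
  apply/hasP => -[j]; rewrite mem_iota add1n ltnS => /andP[_ lej] /eqP uj; rewrite -uj in lt1 lt2.
  case: (leqP j x.1.1) => [le|gt].
    by move: lt1; rewrite ltnNge (chain_leq ch le) // leqW.
  by move: lt2; rewrite ltnNge (chain_leq ch gt) // leqW.
move: (lC); rewrite mem_filter mem_lists => /andP[cl /andP[_ /allP lsub]].
(* A false claim of [l] would meet an objection that consists of true claims, and the clause of this
   objection could only be satisfied by refuting one of them. *)
have tl p : p \in l -> value a c p.1 = p.2.
  move=> pl; have := lsub p pl; rewrite /= mem_filter mem_claims => /andP[lev ltp].
  apply/eqP; apply: contraT => np.
  have [|m [sm tm cm]] := @refutation a c wf d 1 p.1 p.2 ltp _ np; first by case: (p) lev.
  have [|P [_ PD]] := HD ((2, 0), (l, m)).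
    rewrite !mem_cat; apply/orP; right; apply/orP; right; apply/map_f; rewrite mem_filter; apply/andP; split.
      by apply/hasP; exists p.
    apply/allpairsP; exists (l, m); split=> //=.
    by rewrite mem_lists sm (true_level_sub tm).
  rewrite /satisfies /= => /orP[/hasP[x /PD xD /andP[/eqP xk]]|/hasP[p' pm cp']].
    by rewrite (inj x (X k.+1)) ?topE // El /= eqxx.
  have [_ /eqP vp' ltp'] := and3P (allP tm p' pm).
  suff : value a c p'.1 = ~~ p'.2 by rewrite vp'; case: (p'.2).
  by apply: certifies_sound ltp' cp' => // j b' ltj; apply: cov.
rewrite circuit_valueE -/out; apply: certifies_sound out_lt cl => // j b' _ /tl //.
Qed.

End CoveringCorrect.

(** * From covering problems to vertex removal *)

(* Once all items of a term are deleted, the vertex [s] of the term has no neighbours outside of the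
   triangle of its clause. *)
Definition triangle_sentence : sentence :=
  let w := @Ordinal 5 0 isT in let s := @Ordinal 5 1 isT in let x3 := @Ordinal 5 2 isT in
  let x2 := @Ordinal 5 3 isT in let x1 := @Ordinal 5 4 isT in
  All (All (All (Ex (All (Matrix
    (Imp (And (Adj x1 x2) (And (Adj x1 x3) (Adj x2 x3)))
      (And (Not (Or (Equal s x1) (Or (Equal s x2) (Equal s x3))))
        (And (Or (Adj s x1) (Or (Adj s x2) (Adj s x3)))
          (Imp (Adj w s) (Or (Equal w x1) (Or (Equal w x2) (Equal w x3)))))))))))).

Lemma triangle_sentence_Pi : Pi 3 triangle_sentence.
Proof. by do 3! apply: Pi_All; apply/Pi_Sigma/Sigma_Ex/Sigma_Pi/Pi_All/Pi_Sigma/Sigma_qf. Qed.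

(** Prenex form places the triangle hypothesis below all quantifiers, so some [s] has to be named
    for non-triangles too. *)
Lemma triangle_sentenceP (G : sgraph) : models G triangle_sentence <->
  forall x1 x2 x3 : vertex G, exists s, forall w,
    [&& adj x1 x2, adj x1 x3 & adj x2 x3] ->
    [/\ s \notin [:: x1; x2; x3], has (adj s) [:: x1; x2; x3] &
        adj w s -> w \in [:: x1; x2; x3]].
Proof.
rewrite /models /triangle_sentence /=; split=> H x1 x2 x3; have [s Hs] := H x1 x2 x3;
  exists s => w; have := Hs w.
  rewrite !(tnth_nth x1) /= => /implyP Himp /Himp /and3P[n a b].
  by rewrite !inE orbF; split=> // aws; apply: (implyP b).
move=> Himp; rewrite !(tnth_nth x1) /=; apply/implyP => /Himp[n a b].
rewrite !inE /= orbF in n a b; rewrite n a; exact/implyP.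
Qed.

Section CoveringGraph.
Variables (T C : eqType) (cl0 : C) (sat : C -> seq T -> bool).

(* The vertex [((t, j), (cl, P))] is of kind [t]: items have [t = 0]; copy [j] of the clause [cl] has
   the triangle of corners [t = 1, 2, 3] and the vertices [t = 4] for all terms [P] that satisfy the
   clause, which are attached to corner 1 and to the items of [P]. *)
Definition gvertex := ((nat * nat) * (C * seq T))%type.
Definition item_vertex (w : T) : gvertex := ((0, 0), (cl0, [:: w])).
Definition corner (t j : nat) (cl : C) : gvertex := ((t, j), (cl, [::])).
Definition term_vertex (j : nat) (cl : C) (P : seq T) : gvertex := ((4, j), (cl, P)).

(** An item has one vertex for all clauses and copies, so its adjacency to terms ignores both.
    Corners 2 and 3 have no neighbours outside of their triangle. *)
Definition half_adj (x y : gvertex) : bool :=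
  [&& x.1.1 == 0, y.1.1 == 4 & has (fun w => w \in y.2.2) x.2.2] ||
  ((x.1.2 == y.1.2) && ((x.2.1 == y.2.1) &&
    ([&& x.1.1 == 1, y.1.1 == 4 & sat y.2.1 y.2.2] ||
     [&& 0 < x.1.1, x.1.1 < y.1.1 & y.1.1 <= 3]))).

Definition gadj (x y : gvertex) : bool := half_adj x y || half_adj y x.

Definition copies (cls : seq C) (k : nat) : seq (nat * C) :=
  [seq (j, cl) | j <- iota 0 k.+1, cl <- cls].

Lemma mem_copies cls k jc : (jc \in copies cls k) = (jc.1 <= k) && (jc.2 \in cls).
Proof.
apply/allpairsP/andP => [[[j cl] [+ clc ->]]|[jk clc]]; first by rewrite mem_iota ltnS.
by exists jc; rewrite mem_iota ltnS; case: jc jk clc.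
Qed.

(** Terms that fail a clause get a vertex as well; it is adjacent to no corner and cannot serve as
    [s]. Without repetitions, positions in the list and vertices correspond one to one. *)
Definition gvertices (I : seq T) (terms : seq (seq T)) (cls : seq C) (k : nat) : seq gvertex :=
  dedup ([seq item_vertex w | w <- I] ++
    ([seq ((t, jc.1), (jc.2, [::])) | t <- [:: 1; 2; 3], jc <- copies cls k] ++
     [seq ((4, jc.1), (jc.2, P)) | jc <- copies cls k, P <- terms])).

Lemma gadj_sym : symmetric gadj.
Proof. by move=> x y; rewrite /gadj orbC. Qed.

Lemma gadj_irr : irreflexive gadj.
Proof.
move=> [[t j] [cl P]]; rewrite /gadj orbb /half_adj /= ltnn andbF.
by case: t => [|[|t]]; rewrite /= ?andbF.
Qed.

Section OfList.
Variables (V : seq gvertex) (v0 : gvertex).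

Definition list_adj : rel 'I_(size V) := fun u v => gadj (nth v0 V u) (nth v0 V v).

Lemma list_adj_sym : symmetric list_adj.
Proof. by move=> u v; apply: gadj_sym. Qed.

Lemma list_adj_irr : irreflexive list_adj.
Proof. by move=> u; apply: gadj_irr. Qed.

Definition list_graph : sgraph := SGraph list_adj_sym list_adj_irr.

Lemma adjacency_list_graph : adjacency list_graph = [seq [seq gadj x y | y <- V] | x <- V].
Proof.
rewrite /adjacency -[in RHS](mkseq_nth v0 V) /mkseq -val_enum_ord -!map_comp.
by apply: eq_map => u /=; rewrite -!map_comp; apply: eq_map.
Qed.
End OfList.

Variables (I : seq T) (terms : seq (seq T)) (cls : seq C) (k : nat).
Let V := gvertices I terms cls k.

Lemma mem_gvertices (x : gvertex) : x \in V <-> [\/ exists2 w, w \in I & x = item_vertex w,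
  exists t j cl, [/\ 0 < t <= 3, j <= k, cl \in cls & x = corner t j cl] |
  exists j cl P, [/\ j <= k, cl \in cls, P \in terms & x = term_vertex j cl P]].
Proof.
rewrite (dedup_uniq_mem _).2 2!mem_cat; split=> [/or3P[]|].
- by case/mapP=> w wI ->; constructor 1; exists w.
- case/allpairsP=> -[t [j cl]] [/= t3]; rewrite mem_copies => /andP[jk clc] ->.
  constructor 2; exists t, j, cl; split=> //.
  by move: t3; rewrite !inE => /or3P[] /eqP->.
- case/allpairsP=> -[[j cl] P] [/=]; rewrite mem_copies => /andP[jk clc] Pt ->.
  by constructor 3; exists j, cl, P.
case=> [[w wI ->]|[t [j [cl [t3 jk clc ->]]]]|[j [cl [P [jk clc Pt ->]]]]].
- by rewrite map_f.
- apply/orP; right; apply/orP; left; apply/allpairsP; exists (t, (j, cl)).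
  by split; rewrite /= ?mem_copies /= ?jk //; case: t t3 => [|[|[|[|t]]]].
- apply/orP; right; apply/orP; right; apply/allpairsP; exists ((j, cl), P).
  by split; rewrite /= ?mem_copies /= ?jk.
Qed.

Lemma gadj_kinds x y : gadj x y ->
  [\/ x.1.1 < 2 /\ y.1.1 = 4, y.1.1 < 2 /\ x.1.1 = 4 |
      [/\ 0 < x.1.1 <= 3, 0 < y.1.1 <= 3, x.1.1 <> y.1.1, x.1.2 = y.1.2 & x.2.1 = y.2.1]].
Proof.
case/orP=> /orP[/and3P[/eqP-> /eqP-> _]|/and3P[/eqP E1 /eqP E2]]; try by [constructor 1|constructor 2].
  case/orP=> [/and3P[/eqP-> /eqP-> _]|/and3P[h1 h2 h3]]; first by constructor 1.
  by constructor 3; split=> //; try apply/andP; try split; try lia.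
case/orP=> [/and3P[/eqP-> /eqP-> _]|/and3P[h1 h2 h3]]; first by constructor 2.
by constructor 3; split=> //; try apply/andP; try split; try lia.
Qed.

Lemma gadj_corner_term t j cl j' cl' P : gadj (corner t j cl) (term_vertex j' cl' P) =
  [&& t == 1, j == j', cl == cl' & sat cl' P].
Proof.
rewrite /gadj /half_adj /=.
by case: t => [|[|[|[|t]]]]; rewrite /= ?andbF ?orbF ?andbF ?orbF.
Qed.

Lemma corner_of_kind (x : gvertex) : x \in V -> 0 < x.1.1 <= 3 ->
  [/\ x = corner x.1.1 x.1.2 x.2.1, x.1.2 <= k & x.2.1 \in cls].
Proof. by move/mem_gvertices=> [[w _ ->]|[t [j [cl [_ jk clc ->]]]] _|[j [cl [P [_ _ _ ->]]]]]. Qed.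

(** A term is adjacent only to items and first corners, which are pairwise non-adjacent, and an item
    only to terms; so neither occurs in a triangle. *)
Lemma triangle_kinds (x y z : gvertex) : gadj x y -> gadj x z -> gadj y z ->
  [/\ 0 < x.1.1 <= 3, 0 < y.1.1 <= 3 & 0 < z.1.1 <= 3].
Proof.
move=> /gadj_kinds xy /gadj_kinds xz /gadj_kinds yz.
have [] : 0 < x.1.1 <= 3 /\ (0 < y.1.1 <= 3 /\ 0 < z.1.1 <= 3); last by move=> ? [].
case: xy => [[h1 h2]|[h1 h2]|[h1 h2 h _ _]]; case: xz => [[h3 h4]|[h3 h4]|[h3 h4 h5 _ _]];
  case: yz => [[h6 h7]|[h6 h7]|[h6 h7 h8 _ _]]; lia.
Qed.

Lemma triangle_corners (x y z : gvertex) : x \in V -> y \in V -> z \in V ->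
  gadj x y -> gadj x z -> gadj y z ->
  exists j cl, [/\ j <= k, cl \in cls & corner 1 j cl \in [:: x; y; z]].
Proof.
move=> xV yV zV xy xz yz; have [tx ty tz] := triangle_kinds xy xz yz.
have same u v : 0 < u.1.1 <= 3 -> 0 < v.1.1 <= 3 -> gadj u v ->
    [/\ u.1.1 <> v.1.1, u.1.2 = v.1.2 & u.2.1 = v.2.1].
  by move=> tu tv /gadj_kinds[[_ E]|[_ E]|[]//]; [rewrite E in tv | rewrite E in tu].
have [[nxy jxy cxy] [nxz jxz cxz]] := (same x y tx ty xy, same x z tx tz xz).
have [nyz _ _] := same y z ty tz yz.
have [Ex jk clc] := corner_of_kind xV tx; have [Ey _ _] := corner_of_kind yV ty.
have [Ez _ _] := corner_of_kind zV tz.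
exists x.1.2, x.2.1; split=> //; rewrite !inE.
have [E|[E|E]] : x.1.1 = 1 \/ y.1.1 = 1 \/ z.1.1 = 1 by lia.
- by apply/or3P; constructor 1; rewrite [X in _ == X]Ex E.
- by apply/or3P; constructor 2; rewrite [X in _ == X]Ey E jxy cxy.
- by apply/or3P; constructor 3; rewrite [X in _ == X]Ez E jxz cxz.
Qed.

Variable v0 : gvertex.
Let G := list_graph V v0.
Let at_ (v : vertex G) : gvertex := nth v0 V v.

Lemma at_mem v : at_ v \in V.
Proof. exact: mem_nth. Qed.

Lemma at_inj : injective at_.
Proof.
move=> u v /eqP; rewrite nth_uniq ?ltn_ord //; last exact: (dedup_uniq_mem _).1.
by move/eqP/val_inj.
Qed.

Lemma at_onto (x : gvertex) : x \in V -> exists v, at_ v = x.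
Proof.
move=> xV; have lt : index x V < size V by rewrite index_mem.
by exists (Ordinal lt); apply: nth_index.
Qed.

(** Every triangle belongs to a copy of some clause. A term inside [D] that satisfies this clause
    has lost all its items, and its only remaining neighbour is the first corner. *)
Lemma removal_of_cover (D : seq T) :
  size D <= k -> {subset D <= I} ->
  (forall cl, cl \in cls -> exists P, [/\ P \in terms, {subset P <= D} & sat cl P]) ->
  exists S : {set vertex G}, #|S| <= k /\ models (delete S) triangle_sentence.
Proof.
move=> sD DI HD; pose S := [set v | at_ v \in map item_vertex D]; exists S; split.
  rewrite cardE -(size_map at_); apply: leq_trans sD; rewrite -(size_map item_vertex).
  apply: uniq_leq_size; first by rewrite map_inj_uniq ?enum_uniq //; apply: at_inj.
  by move=> x /mapP[v]; rewrite mem_enum inE => vD ->.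
apply/triangle_sentenceP => x1 x2 x3.
have [/and3P[a12 a13 a23]|/negP ntri] := boolP [&& adj x1 x2, adj x1 x3 & adj x2 x3]; last by exists x1.
have [j [cl [jk clc cor]]] := triangle_corners (at_mem _) (at_mem _) (at_mem _) a12 a13 a23.
have [P [Pt PD satP]] := HD cl clc.
have [s sE] : exists s, at_ s = term_vertex j cl P.
  by apply: at_onto; apply/mem_gvertices; constructor 3; exists j, cl, P.
have sS : s \notin S by rewrite inE sE; apply/mapP => -[].
have kinds v : v \in [:: x1; x2; x3] -> (at_ (val v)).1.1 <= 3.
  have [/andP[_ t1] /andP[_ t2] /andP[_ t3]] := triangle_kinds a12 a13 a23.
  by rewrite !inE => /or3P[] /eqP->.
have cor' : exists2 v, v \in [:: x1; x2; x3] & at_ (val v) = corner 1 j cl.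
  by move: cor; rewrite !inE => /or3P[] /eqP->;
    [exists x1 | exists x2 | exists x3]; rewrite // !inE eqxx ?orbT.
pose s' : vertex (delete S) := exist _ s sS; have s'E : at_ (val s') = term_vertex j cl P by [].
exists s' => w _; split.
- by apply/negP => /kinds; rewrite s'E.
- case: cor' => v vX vE; apply/hasP; exists v => //.
  by rewrite /= /del_adj /= /list_adj -!/(at_ _) s'E vE /gadj /half_adj /= !eqxx satP orbT.
rewrite /= /del_adj /= /list_adj -!/(at_ _) s'E => ws.
have wV := at_mem (val w); have wS := valP w; rewrite inE in wS.
case/mem_gvertices: wV => [[w0 w0I wE]|[t [j' [cl' [t3 _ _ wE]]]]|[j' [cl' [P' [_ _ _ wE]]]]]; rewrite wE in ws wS.
- move: ws; rewrite /gadj /half_adj /= ?andbF ?orbF => w0P.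
  by case/negP: wS; apply: map_f; apply: PD.
- have [Et Ej Ec] : [/\ t = 1, j' = j & cl' = cl].
    by move: ws; rewrite gadj_corner_term => /and4P[/eqP-> /eqP-> /eqP->].
  by case: cor' => v vX vE; suff -> : w = v by []; apply/val_inj/at_inj; rewrite vE wE Et Ej Ec.
- by move/gadj_kinds: ws => /= [[]|[]|[]].
Qed.

(** Outside of an intact triangle, only terms satisfying its clause are adjacent to it; so the [s]
    provided by the sentence names a term, and its items must all be deleted. *)
Lemma cover_of_removal (S : {set vertex G}) :
  (forall P, P \in terms -> {subset P <= I}) -> #|S| <= k -> models (delete S) triangle_sentence ->
  exists D, [/\ size D <= k, {subset D <= I} &
    forall cl, cl \in cls -> exists P, [/\ P \in terms, {subset P <= D} & sat cl P]].
Proof.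
move=> tI cS /triangle_sentenceP HS.
pose D := [seq w <- dedup I | item_vertex w \in [seq at_ v | v <- enum S]].
have szS : size [seq at_ v | v <- enum S] <= k by rewrite size_map -cardE.
exists D; split.
- apply: leq_trans szS; rewrite -(size_map item_vertex); apply: uniq_leq_size.
    by rewrite map_inj_uniq ?filter_uniq ?(dedup_uniq_mem _).1 // => w w' [].
  by move=> x /mapP[w]; rewrite mem_filter => /andP[+ _] ->.
- by move=> w; rewrite mem_filter (dedup_uniq_mem _).2 => /andP[].
move=> cl clc.
(* There are [k.+1] copies and at most [k] deleted vertices. Deleted items count as hits of copy 0,
   which is harmless. *)
have [j jk jS] : exists2 j, j <= k & forall v, v \in S -> (at_ v).1.2 != j.
  have /allPn[j jk jS] : ~~ all (mem [seq (at_ v).1.2 | v <- enum S]) (iota 0 k.+1).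
    apply/negP => /allP sub; have := uniq_leq_size (iota_uniq 0 k.+1) sub.
    by rewrite size_iota size_map -(size_map at_) leqNgt ltnS szS.
  exists j; first by move: jk; rewrite mem_iota ltnS.
  by move=> v vS; apply: contraNneq jS => <-; rewrite /= (map_f (fun v => (at_ v).1.2)) ?mem_enum.
have cornerV t : 0 < t <= 3 -> exists v : vertex (delete S), at_ (val v) = corner t j cl.
  move=> t3; have [|v vE] := @at_onto (corner t j cl); first by apply/mem_gvertices; constructor 2; exists t, j, cl.
  have vS : v \notin S by apply/negP => /jS; rewrite vE eqxx.
  by exists (exist _ v vS).
have [[x1 E1] [[x2 E2] [x3 E3]]] := (cornerV 1 isT, (cornerV 2 isT, cornerV 3 isT)).
have tri : [&& adj x1 x2, adj x1 x3 & adj x2 x3].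
  by rewrite /= /del_adj /= /list_adj -!/(at_ _) E1 E2 E3 /gadj /half_adj /= !eqxx.
have [s Hs] := HS x1 x2 x3; have [nX aX _] := Hs x1 tri.
have [v [vX sv]] : exists v, v \in [:: x1; x2; x3] /\ gadj (at_ (val s)) (at_ (val v)).
  by have /hasP[v vX sv] := aX; exists v.
have [t [t3 vE]] : exists t, 0 < t <= 3 /\ at_ (val v) = corner t j cl.
  by move: vX; rewrite !inE => /or3P[] /eqP->; [exists 1 | exists 2 | exists 3].
have sX t' : 0 < t' <= 3 -> at_ (val s) <> corner t' j cl.
  move=> t3' sE; case/negP: nX; rewrite !inE; apply/or3P.
  by move: t3' sE; case: t' => [|[|[|[|t']]]] // _;
    rewrite -?E1 -?E2 -?E3 => /at_inj/val_inj->; [constructor 1 | constructor 2 | constructor 3].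
rewrite vE in sv; case/mem_gvertices: (at_mem (val s)) => [[w0 w0I sE]|[t' [j' [cl' [t3' _ _ sE]]]]|[j' [cl' [P [_ _ Pt sE]]]]].
- by rewrite sE in sv; move/gadj_kinds: sv => /= [[]|[]|[]] //=; move: t3 => /andP[]; case: (t) => [|[|[|[|]]]].
- rewrite sE in sv; move/gadj_kinds: sv => /= [[_ h]|[_ h]|[_ _ _ hj hc]]; [by move: t3; rewrite h|by move: t3'; rewrite h|].
  by case: (sX t' t3'); rewrite sE hj hc.
have [jE cE sP] : [/\ j' = j, cl' = cl & sat cl P].
  by move: sv; rewrite sE gadj_sym gadj_corner_term => /and4P[_ /eqP<- /eqP<-].
exists P; split=> // w wP; have wI := tI P Pt w wP.
rewrite mem_filter (dedup_uniq_mem _).2 wI andbT.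
have [|u uE] := @at_onto (item_vertex w); first by apply/mem_gvertices; constructor 1; exists w.
rewrite -uE map_f // mem_enum; apply: contraT => uS.
have [_ _] := Hs (exist _ u uS : vertex (delete S)) tri; rewrite /= /del_adj /= /list_adj -!/(at_ _) uE sE.
rewrite /gadj /half_adj /= wP => /(_ isT); rewrite !inE.
by case/or3P=> /eqP/(congr1 (fun v => at_ (val v))); rewrite [at_ _]uE ?E1 ?E2 ?E3.
Qed.

End CoveringGraph.

(** * The reduction runs in polynomial time *)

Section ReductionTime.
Variable d : nat.

Lemma ptime_claims X (EX : encodable X) (c : X -> seq gate) :
  ptime c -> ptime (fun x => claims (c x)).
Proof. by move=> Pc; rewrite /claims; pt. Qed.

Lemma ptime_level_claims w X (EX : encodable X) (c : X -> seq gate) :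
  ptime c -> ptime (fun x => [seq p <- claims (c x) | of_level (c x) d w p]).
Proof. by move=> Pc; apply: ptime_filter; [exact: ptime_claims | apply: ptime_of_level; pt]. Qed.

Lemma ptime_certifies_claimed X (EX : encodable X) (l : X -> seq claim) (c : X -> seq gate) i b :
  ptime l -> ptime c -> ptime i -> ptime b ->
  ptime (fun x => certifies (c x) (claimed (l x)) d (i x) (b x)).
Proof. by move=> *; apply: ptime_certifies => //; rewrite /claimed; pt. Qed.

Lemma ptime_certificates X (EX : encodable X) (c : X -> seq gate) :
  ptime c -> ptime (fun x => certificates (c x) d).
Proof.
move=> Pc; apply: ptime_filter; first exact/ptime_lists/ptime_level_claims.
by apply: ptime_certifies_claimed; pt.
Qed.

Lemma ptime_objections X (EX : encodable X) (c : X -> seq gate) :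
  ptime c -> ptime (fun x => objections (c x) d).
Proof. by move=> Pc; exact/ptime_lists/ptime_level_claims. Qed.

Lemma ptime_items X (EX : encodable X) (c : X -> seq gate) (k : X -> nat) :
  ptime c -> ptime k -> ptime (fun x => items (c x) (k x) d).
Proof.
move=> Pc Pk; apply: ptime_cat; first by rewrite /steps /step_ok; pt.
by apply: ptime_map; [exact: ptime_certificates | pt].
Qed.

Lemma ptime_clauses X (EX : encodable X) (c : X -> seq gate) (k : X -> nat) :
  ptime c -> ptime k -> ptime (fun x => clauses (c x) (k x) d).
Proof.
move=> Pc Pk; apply: ptime_cat; first by pt.
apply: ptime_cat; first by pt.
apply: ptime_map; last by pt.
apply: ptime_filter.
  apply/ptime_flatten/ptime_map; first exact: ptime_certificates.
  by apply: ptime_map; [apply: ptime_objections; pt | pt].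
by apply: ptime_has; [pt | apply: ptime_certifies_claimed; pt].
Qed.

Lemma ptime_satisfies X (EX : encodable X) (c : X -> seq gate) (k : X -> nat)
    (cl : X -> clause) (P : X -> seq item) :
  ptime c -> ptime k -> ptime cl -> ptime P -> ptime (fun x => satisfies (c x) (k x) d (cl x) (P x)).
Proof.
move=> Pc Pk Pcl PP; rewrite /satisfies; apply: ptime_if; first by pt.
  by pt.
apply: ptime_if; first by pt.
  by pt.
apply: ptime_orb; first by pt.
apply: ptime_has; first by pt.
apply: (@ptime_certifies d _ (seq gate * seq item) _ _ (fun y => covered y.1 y.2)
  (fun q => (c q.2, P q.2))); [rewrite /covered | | | |]; by pt.
Qed.

Lemma ptime_gadj X (EX : encodable X) (c : X -> seq gate) (k : X -> nat) (x y : X -> gvertex item clause) :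
  ptime c -> ptime k -> ptime x -> ptime y ->
  ptime (fun z => gadj (satisfies (c z) (k z) d) (x z) (y z)).
Proof.
move=> Pc Pk Px Py; rewrite /gadj /half_adj.
by repeat first [apply: ptime_satisfies | pt_step].
Qed.

Definition clause0 : clause := ((0, 0), ([::], [::])).

Definition circuit_vertices (c : circuit) (k : nat) : seq (gvertex item clause) :=
  gvertices clause0 (items c k d) (lists (2 ^ d).+1 (items c k d)) (clauses c k d) k.+2.

Lemma ptime_circuit_vertices X (EX : encodable X) (c : X -> seq gate) (k : X -> nat) :
  ptime c -> ptime k -> ptime (fun x => circuit_vertices (c x) (k x)).
Proof.
move=> Pc Pk; have PI := ptime_items Pc Pk; have PL := ptime_lists (2 ^ d).+1 PI.
have PC := ptime_clauses Pc Pk; rewrite /circuit_vertices; apply: ptime_dedup.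
have PK : ptime (fun x => copies (clauses (c x) (k x) d) (k x).+2).
  by apply/ptime_flatten/ptime_map; [pt | apply: ptime_map; [apply: ptime_clauses; pt | pt]].
apply: ptime_cat; first by apply: ptime_map; rewrite // /item_vertex; pt.
apply: ptime_cat; apply/ptime_flatten/ptime_map; [pt | | exact: PK |].
  by apply: ptime_map; [apply: (ptime_comp PK); pt | pt].
by apply: ptime_map; [apply: (ptime_comp PL); pt | pt].
Qed.

Definition reduction (p : seq gate * nat) : matrix * nat :=
  ([seq [seq gadj (satisfies p.1 p.2 d) x y | y <- circuit_vertices p.1 p.2]
      | x <- circuit_vertices p.1 p.2], p.2.+2).

Lemma ptime_reduction : ptime reduction.
Proof.
have PV : ptime (fun p : seq gate * nat => circuit_vertices p.1 p.2) by apply: ptime_circuit_vertices; pt.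
apply: ptime_pair; last by pt.
by apply: ptime_map => //; apply: ptime_map; [apply: ptime_circuit_vertices; pt | apply: ptime_gadj; pt].
Qed.

End ReductionTime.

(** The depth [d] depends on the problem [Q]; it affects the graph and the exponent of the running
    time, but not the formula. *)
Lemma W2_hard_vertex_removal : W_hard 2 (vertex_removal triangle_sentence).
Proof.
move=> Q [d _ red].
apply: (@fpt_reduces_ptime Q (weighted_circuit_sat 2 d) _ _ _ _ _
  (fun x : inst (weighted_circuit_sat 2 d) => (val x.1, x.2)) (reduction d) 2 _ (ptime_reduction d) _ red).
  by case=> c k.
case=> -[c c_ok] k; have /and3P[wf w2 dd] := c_ok.
pose V := circuit_vertices d c k; pose v0 : gvertex item clause := ((0, 0), (clause0, [::])).
exists (list_graph (satisfies c k d) V v0, k.+2); split=> /=.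
- by rewrite adjacency_code adjacency_list_graph.
- by rewrite addn2.
split=> [[a wa va]|[S [cS HS]]].
  have [D [DI sD HD]] := covering_of_weight wf dd w2 wa va.
  exact: removal_of_cover sD DI HD.
have [|D [sD DI HD]] := @cover_of_removal _ _ clause0 _ _ _ _ _ _ S _ cS HS.
  by move=> P; rewrite mem_lists => /andP[_ /allP].
exact: (@weight_of_covering c k d wf D).
Qed.

Theorem theorem1 :
  (forall phi : sentence, Sigma 3 phi -> FPT (vertex_removal phi)) /\
  (exists phi : sentence, Pi 3 phi /\ W_hard 2 (vertex_removal phi)).
Proof.
split; first exact: FPT_vertex_removal.
by exists triangle_sentence; split; [exact: triangle_sentence_Pi | exact: W2_hard_vertex_removal].
Qed.
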